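(* There is a set $A$ which is $\omega$-c.e. (i.e. $A\le_{wtt}\emptyset'$) and jump traceable but not BLR traceable.
   Context: An order function is a computable nondecreasing unbounded function. $A$ is jump traceable if there is an order function $h$ and a uniformly c.e. sequence of finite sets $(T_x)$ with $|T_x|\le h(x)$ such that $J^A(x)\in T_x$ whenever $J^A(x)\downarrow$, where $J^A$ is the universal $A$-partial computable function (the jump function). A function is $\omega$-c.e. by $A$ if it is $\lim_t\Gamma^A(x,t)$ for an $A$-computable $\Gamma^A$ whose number of changes at $x$ is bounded by a computable function. A BLR trace is $(T_n)$ with $T_n=W_{r(n)}$ for an $\omega$-c.e. function $r$ (limit of a computable approximation with computably bounded number of changes); bound $h$ means $|T_n|\le h(n)$. $A$ is BLR traceable if for some order $h$, every function $f$ that is $\omega$-c.e. by $A$ has a BLR trace with bound $h$ containing $f(n)$ in $T_n$ for all $n$. *)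

(* Defs.v *)
From Stdlib Require Import Arith List Cantor.
Import ListNotations.

Definition pair (x y : nat) : nat := Cantor.to_nat (x, y).
Definition fst_of (n : nat) : nat := fst (Cantor.of_nat n).
Definition snd_of (n : nat) : nat := snd (Cantor.of_nat n).

Inductive code : Type :=
| CZero
| CSucc
| CId
| CFst
| CSnd
| COrc
| CComp (f g : code)
| CPair (f g : code)
| CRec (f g : code)
| CMu (f : code).

Inductive evalR (O : nat -> bool) : code -> nat -> nat -> Prop :=
| eZero x : evalR O CZero x 0
| eSucc x : evalR O CSucc x (S x)
| eId x : evalR O CId x x
| eFst x : evalR O CFst x (fst_of x)
| eSnd x : evalR O CSnd x (snd_of x)
| eOrc x : evalR O COrc x (if O x then 1 else 0)
| eComp f g x y z : evalR O g x y -> evalR O f y z -> evalR O (CComp f g) x z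
| ePair f g x y z : evalR O f x y -> evalR O g x z -> evalR O (CPair f g) x (pair y z)
| eRec0 f g x y : evalR O f x y -> evalR O (CRec f g) (pair x 0) y
| eRecS f g x k y z :
    evalR O (CRec f g) (pair x k) y ->
    evalR O g (pair x (pair k y)) z ->
    evalR O (CRec f g) (pair x (S k)) z
| eMu f x n :
    evalR O f (pair x n) 0 ->
    (forall m, m < n -> exists v, v <> 0 /\ evalR O f (pair x m) v) ->
    evalR O (CMu f) x n.

Fixpoint dec (fuel n : nat) : code :=
  match fuel with
  | 0 => CZero
  | S k =>
    let t := n mod 10 in
    let r := n / 10 in
    let a := fst_of r in
    let b := snd_of r in
    match t with
    | 0 => CZero | 1 => CSucc | 2 => CId | 3 => CFst | 4 => CSnd | 5 => COrc
    | 6 => CComp (dec k a) (dec k b)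
    | 7 => CPair (dec k a) (dec k b)
    | 8 => CRec (dec k a) (dec k b)
    | _ => CMu (dec k r)
    end
  end.

Definition decode (e : nat) : code := dec (S e) e.

Definition Phi (O : nat -> bool) (e x y : nat) : Prop := evalR O (decode e) x y.

Definition emptyO : nat -> bool := fun _ => false.

Definition J (A : nat -> bool) (x y : nat) : Prop := Phi A x x y.

Definition W (e y : nat) : Prop := exists v, Phi emptyO e y v.

Definition computable (f : nat -> nat) : Prop :=
  exists e, forall x, Phi emptyO e x (f x).

Definition order_fun (h : nat -> nat) : Prop :=
  computable h /\ (forall x y, x <= y -> h x <= h y) /\
  (forall m, exists x, m <= h x).

Definition card_le (S : nat -> Prop) (k : nat) : Prop :=
  forall l : list nat, NoDup l -> (forall y, In y l -> S y) -> length l <= k.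

Definition unif_ce (T : nat -> nat -> Prop) : Prop :=
  exists e, forall x y, T x y <-> W e (pair x y).

Definition changes_le (g : nat -> nat) (k : nat) : Prop :=
  card_le (fun s => g s <> g (S s)) k.

Definition omega_ce_by (O : nat -> bool) (f : nat -> nat) : Prop :=
  exists (c : nat) (G : nat -> nat -> nat) (b : nat -> nat),
    (forall x t, Phi O c (pair x t) (G x t)) /\
    computable b /\
    (forall x, changes_le (G x) (b x)) /\
    (forall x, exists t0, forall t, t0 <= t -> G x t = f x).

Definition omega_ce_fun (r : nat -> nat) : Prop := omega_ce_by emptyO r.

Definition char_fun (A : nat -> bool) : nat -> nat :=
  fun x => if A x then 1 else 0.

Definition omega_ce_set (A : nat -> bool) : Prop := omega_ce_fun (char_fun A).

Definition jump_traceable (A : nat -> bool) : Prop :=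
  exists (h : nat -> nat) (T : nat -> nat -> Prop),
    order_fun h /\ unif_ce T /\ (forall x, card_le (T x) (h x)) /\
    (forall x y, J A x y -> T x y).

Definition BLR_trace_for (h f : nat -> nat) : Prop :=
  exists r : nat -> nat,
    omega_ce_fun r /\
    (forall n, card_le (W (r n)) (h n)) /\
    (forall n, W (r n) (f n)).

Definition BLR_traceable (A : nat -> bool) : Prop :=
  exists h, order_fun h /\
    forall f, omega_ce_by A f -> BLR_trace_for h f.

(* Main.v *)
Require Import Defs.
From Stdlib Require Import Arith List Cantor Lia Classical ClassicalEpsilon.
Import ListNotations.

(* Along a path of levels, a string is first extended, if possible, so as to make
   the jump at [x] halt, and then a branch [j <= x] is coded by appending
   [0^(N+j) 1].  Each search for an extension changes its outcome once, so for a
   fixed choice of branches the string at level [x] changes a computably bounded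
   number of times; since only [x!] choices lead to level [x], tracing all of
   them makes the limit set jump traceable whatever branches it finally takes.
   The branch at level [x] is a guess at a number outside one candidate trace of
   size at most [x], and it may change as often as a bound [N] that is computed
   only during the construction.  The padding [0^N] keeps these changes beyond
   position [N], so a given bit of the set still changes a computably bounded
   number of times.  With the set as oracle, the branches are read off from the
   current strings without looking at the guesses, hence with a computably
   bounded number of changes. *)

(** An opponent is an [omega]-c.e. function [r], given by a code [c] for its approximation and a
    code [d] for its change bound. Totality of codes cannot be checked, so the argument [pair c d]
    is reserved for this opponent, and its guess stays at [0] until [d] has converged there. This is
    the obstacle: the number of changes allowed to a guess is only a partial computable function of
    the level, and coding the guess directly behind the string would pass all these changes on to
    low bits of the set. The bound itself, however, passes from unknown to known only once, so the
    padding costs a single change at each level. The bound [h] of the opponent is never guessed: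
    every argument [n] and every size [k] have a level [pair n k] of their own, and [h] enters only
    when the function to be traced is defined, through the level [pair n (h n)]. A set with at most
    [k] elements misses one of [0, ..., k], and [k <= pair n k], which is why branches up to [x]
    suffice at level [x]. *)

(** * Pairing, induction on evaluations, and the numbering of codes *)

Lemma fst_pair a b : fst_of (pair a b) = a.
Proof. unfold fst_of, pair. now rewrite Cantor.cancel_of_to. Qed.

Lemma snd_pair a b : snd_of (pair a b) = b.
Proof. unfold snd_of, pair. now rewrite Cantor.cancel_of_to. Qed.

Lemma pair_eta n : pair (fst_of n) (snd_of n) = n.
Proof.
  unfold pair, fst_of, snd_of. rewrite <- surjective_pairing. apply Cantor.cancel_to_of.
Qed.

Lemma fst_le n : fst_of n <= n.
Proof.
  rewrite <- (pair_eta n) at 2. unfold pair.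
  pose proof (Cantor.to_nat_non_decreasing (fst_of n) (snd_of n)). lia.
Qed.

Lemma snd_le n : snd_of n <= n.
Proof.
  rewrite <- (pair_eta n) at 2. unfold pair.
  pose proof (Cantor.to_nat_non_decreasing (fst_of n) (snd_of n)). lia.
Qed.

#[local] Opaque pair fst_of snd_of Nat.div Nat.modulo.

Section EvalInd.
  Variables (O : nat -> bool) (P : code -> nat -> nat -> Prop).
  Hypothesis HZero : forall x, P CZero x 0.
  Hypothesis HSucc : forall x, P CSucc x (S x).
  Hypothesis HId : forall x, P CId x x.
  Hypothesis HFst : forall x, P CFst x (fst_of x).
  Hypothesis HSnd : forall x, P CSnd x (snd_of x).
  Hypothesis HOrc : forall x, P COrc x (if O x then 1 else 0).
  Hypothesis HComp : forall f g x y z, P g x y -> P f y z -> P (CComp f g) x z.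
  Hypothesis HPair : forall f g x y z, P f x y -> P g x z -> P (CPair f g) x (pair y z).
  Hypothesis HRec0 : forall f g x y, P f x y -> P (CRec f g) (pair x 0) y.
  Hypothesis HRecS : forall f g x k y z,
    P (CRec f g) (pair x k) y -> P g (pair x (pair k y)) z ->
    P (CRec f g) (pair x (S k)) z.
  Hypothesis HMu : forall f x n, P f (pair x n) 0 ->
    (forall m, m < n -> exists v, v <> 0 /\ P f (pair x m) v) -> P (CMu f) x n.

  (* The induction principle generated by Rocq has no hypothesis for the
     evaluations nested under the existential of [eMu]. *)
  Fixpoint evalR_nested_ind c x y (H : evalR O c x y) {struct H} : P c x y :=
    match H in evalR _ c x y return P c x y with
    | eZero _ x => HZero x
    | eSucc _ x => HSucc x
    | eId _ x => HId x
    | eFst _ x => HFst x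
    | eSnd _ x => HSnd x
    | eOrc _ x => HOrc x
    | eComp _ f g x y z h1 h2 =>
        HComp f g x y z (evalR_nested_ind _ _ _ h1) (evalR_nested_ind _ _ _ h2)
    | ePair _ f g x y z h1 h2 =>
        HPair f g x y z (evalR_nested_ind _ _ _ h1) (evalR_nested_ind _ _ _ h2)
    | eRec0 _ f g x y h => HRec0 f g x y (evalR_nested_ind _ _ _ h)
    | eRecS _ f g x k y z h1 h2 =>
        HRecS f g x k y z (evalR_nested_ind _ _ _ h1) (evalR_nested_ind _ _ _ h2)
    | eMu _ f x n h1 h2 =>
        HMu f x n (evalR_nested_ind _ _ _ h1)
          (fun m lt =>
             match h2 m lt with
             | ex_intro _ v (conj nz hv) =>
                 ex_intro _ v (conj nz (evalR_nested_ind _ _ _ hv))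
             end)
    end.
End EvalInd.

Lemma dec_fuel k l n : n < k -> n < l -> dec k n = dec l n.
Proof.
  revert l n; induction k as [|k IH]; intros [|l] n Hk Hl; try lia. simpl.
  (* Only at [0] does division by 10 fail to decrease, and there the digit [0] ends the decoding. *)
  assert (Hd : n = 0 \/ n / 10 < n) by
    (destruct n; [now left | right; apply Nat.div_lt; lia]).
  destruct Hd as [-> | Hd]; [reflexivity |].
  assert (E : forall m, m <= n / 10 -> dec k m = dec l m) by (intros; apply IH; lia).
  rewrite (E (fst_of (n / 10))), (E (snd_of (n / 10))), (E (n / 10));
    auto using fst_le, snd_le.
Qed.

Lemma decode_eq e :
  decode e =
    let r := e / 10 in
    match e mod 10 with
    | 0 => CZero | 1 => CSucc | 2 => CId | 3 => CFst | 4 => CSnd | 5 => COrc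
    | 6 => CComp (decode (fst_of r)) (decode (snd_of r))
    | 7 => CPair (decode (fst_of r)) (decode (snd_of r))
    | 8 => CRec (decode (fst_of r)) (decode (snd_of r))
    | _ => CMu (decode r)
    end.
Proof.
  unfold decode. change (dec (S e) e) with
    (let r := e / 10 in
    match e mod 10 with
    | 0 => CZero | 1 => CSucc | 2 => CId | 3 => CFst | 4 => CSnd | 5 => COrc
    | 6 => CComp (dec e (fst_of r)) (dec e (snd_of r))
    | 7 => CPair (dec e (fst_of r)) (dec e (snd_of r))
    | 8 => CRec (dec e (fst_of r)) (dec e (snd_of r))
    | _ => CMu (dec e r)
    end).
  cbv zeta.
  assert (Hd : e = 0 \/ e / 10 < e) by
    (destruct e; [now left | right; apply Nat.div_lt; lia]).
  destruct Hd as [-> | Hd]; [reflexivity |].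
  pose proof (fst_le (e / 10)). pose proof (snd_le (e / 10)).
  rewrite (dec_fuel e (S (fst_of (e / 10)))), (dec_fuel e (S (snd_of (e / 10)))),
    (dec_fuel e (S (e / 10))); auto; lia.
Qed.

Lemma decode_digit r t : t < 10 ->
  decode (10 * r + t) =
    match t with
    | 0 => CZero | 1 => CSucc | 2 => CId | 3 => CFst | 4 => CSnd | 5 => COrc
    | 6 => CComp (decode (fst_of r)) (decode (snd_of r))
    | 7 => CPair (decode (fst_of r)) (decode (snd_of r))
    | 8 => CRec (decode (fst_of r)) (decode (snd_of r))
    | _ => CMu (decode r)
    end.
Proof.
  intros Ht. rewrite decode_eq.
  replace ((10 * r + t) / 10) with r by (apply (Nat.div_unique _ 10 r t); lia).
  replace ((10 * r + t) mod 10) with t by (apply (Nat.mod_unique _ 10 r t); lia).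
  reflexivity.
Qed.

Lemma decode_surj c : exists e, decode e = c.
Proof.
  induction c as [| | | | | | f [a Ha] g [b Hb] | f [a Ha] g [b Hb]
                 | f [a Ha] g [b Hb] | f [a Ha]].
  - exists (10 * 0 + 0). now rewrite decode_digit by lia.
  - exists (10 * 0 + 1). now rewrite decode_digit by lia.
  - exists (10 * 0 + 2). now rewrite decode_digit by lia.
  - exists (10 * 0 + 3). now rewrite decode_digit by lia.
  - exists (10 * 0 + 4). now rewrite decode_digit by lia.
  - exists (10 * 0 + 5). now rewrite decode_digit by lia.
  - exists (10 * pair a b + 6). rewrite decode_digit by lia.
    now rewrite fst_pair, snd_pair, Ha, Hb.
  - exists (10 * pair a b + 7). rewrite decode_digit by lia.
    now rewrite fst_pair, snd_pair, Ha, Hb.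
  - exists (10 * pair a b + 8). rewrite decode_digit by lia.
    now rewrite fst_pair, snd_pair, Ha, Hb.
  - exists (10 * a + 9). rewrite decode_digit by lia. now rewrite Ha.
Qed.

Fixpoint prec (b : nat) (st : nat -> nat -> nat) (n : nat) : nat :=
  match n with 0 => b | S k => st k (prec b st k) end.

Lemma prec_add b st m n :
  prec b st (m + n) = prec (prec b st m) (fun k => st (m + k)) n.
Proof.
  induction n as [|n IH]; [now rewrite Nat.add_0_r |].
  rewrite Nat.add_succ_r. simpl. now rewrite IH.
Qed.

(** * A stack machine for oracle codes *)

(* Configurations are numbers: [mkE e x K] is about to evaluate the code with
   index [e] at [x] and [mkR v K] returns [v] to the stack [K], a list of
   suspended frames coded with [0] as nil and [push] as cons. *)
Definition mkE e x K := pair 0 (pair e (pair x K)).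
Definition mkR v K := pair 1 (pair v (pair 0 K)).
Definition push fr K := S (pair fr K).
Definition FComp f := pair 0 f.
Definition FPair1 g x := pair 1 (pair g x).
Definition FPair2 y := pair 2 y.
(** The value at [i] of a recursion with parameter [x] and target [k] is awaited. Recursions are
    iterated upwards from [0], so only the code [g] of the step has to be kept. *)
Definition FRec g x k i := pair 3 (pair g (pair (pair x k) i)).
Definition FMu f x n := pair 4 (pair f (pair x n)).

Definition arg1 c := fst_of (snd_of c).
Definition arg2 c := fst_of (snd_of (snd_of c)).
Definition stack c := snd_of (snd_of (snd_of c)).

Ltac proj := repeat (rewrite fst_pair || rewrite snd_pair).

Definition stepE a e t r x K :=
  if t =? 0 then mkR 0 K
  else if t =? 1 then mkR (S x) K
  else if t =? 2 then mkR x K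
  else if t =? 3 then mkR (fst_of x) K
  else if t =? 4 then mkR (snd_of x) K
  else if t =? 5 then (if a =? 0 then mkE e x K else mkR (pred a) K)
  else if t =? 6 then mkE (snd_of r) x (push (FComp (fst_of r)) K)
  else if t =? 7 then mkE (fst_of r) x (push (FPair1 (snd_of r) x) K)
  else if t =? 8 then
    mkE (fst_of r) (fst_of x) (push (FRec (snd_of r) (fst_of x) (snd_of x) 0) K)
  else mkE r (pair x 0) (push (FMu r x 0) K).

Definition stepRec v g x k i K :=
  if k <=? i then mkR v K
  else mkE g (pair x (pair i v)) (push (FRec g x k (S i)) K).

Definition stepMu v f x n K :=
  if v =? 0 then mkR n K else mkE f (pair x (S n)) (push (FMu f x (S n)) K).

Definition stepR v t d K :=
  if t =? 0 then mkE d v K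
  else if t =? 1 then mkE (fst_of d) (snd_of d) (push (FPair2 v) K)
  else if t =? 2 then mkR (pair d v) K
  else if t =? 3 then
    stepRec v (fst_of d) (fst_of (fst_of (snd_of d))) (snd_of (fst_of (snd_of d)))
      (snd_of (snd_of d)) K
  else stepMu v (fst_of d) (fst_of (snd_of d)) (snd_of (snd_of d)) K.

(* [a] answers the oracle query [arg2 c]: [0] stands for an undefined answer,
   on which the machine is stuck, and [S b] for the bit [b]. *)
Definition step a c :=
  if fst_of c =? 0
  then stepE a (arg1 c) (arg1 c mod 10) (arg1 c / 10) (arg2 c) (stack c)
  else if stack c =? 0 then c
  else stepR (arg1 c) (fst_of (fst_of (pred (stack c))))
         (snd_of (fst_of (pred (stack c)))) (snd_of (pred (stack c))).

(** Each step receives the answer at [arg2 c] whether or not it is a query; thus [step] is a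
    function of numbers alone. *)
Definition run (q : nat -> nat) (s c : nat) : nat :=
  prec c (fun _ c => step (q (arg2 c)) c) s.

(** The value [0] stands for not halted, and [S v] for halted with result [v]. *)
Definition out c :=
  if fst_of c =? 0 then 0 else if stack c =? 0 then S (arg1 c) else 0.

Definition eval_steps (q : nat -> nat) (s e x : nat) : nat := out (run q s (mkE e x 0)).

Lemma arg2_E e x K : arg2 (mkE e x K) = x.
Proof. unfold arg2, mkE. now proj. Qed.

Lemma step_E a e x K : step a (mkE e x K) = stepE a e (e mod 10) (e / 10) x K.
Proof. unfold step, mkE, arg1, arg2, stack. now proj. Qed.

Lemma step_R a v fr K : step a (mkR v (push fr K)) = stepR v (fst_of fr) (snd_of fr) K.
Proof.
  unfold step, mkR, arg1, stack, push. proj. simpl Nat.eqb. cbv iota.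
  rewrite Nat.pred_succ. now proj.
Qed.

Lemma out_E e x K : out (mkE e x K) = 0.
Proof. unfold out, mkE. now proj. Qed.

Lemma out_R v : out (mkR v 0) = S v.
Proof. unfold out, mkR, stack, arg1. now proj. Qed.

Lemma out_push v fr K : out (mkR v (push fr K)) = 0.
Proof. unfold out, mkR, stack, push. now proj. Qed.

Lemma out_halted c v : out c = S v -> fst_of c <> 0 /\ stack c = 0.
Proof.
  unfold out. destruct (Nat.eqb_spec (fst_of c) 0); [easy |].
  now destruct (Nat.eqb_spec (stack c) 0).
Qed.

Lemma step_halted a c v : out c = S v -> step a c = c.
Proof.
  intros [H1 H2]%out_halted. unfold step.
  apply Nat.eqb_neq in H1. now rewrite H1, H2.
Qed.

Lemma run_S q s c : run q (S s) c = step (q (arg2 (run q s c))) (run q s c).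
Proof. reflexivity. Qed.

Lemma run_add q s t c : run q (s + t) c = run q t (run q s c).
Proof. unfold run. now rewrite prec_add. Qed.

Lemma run_1 q s c : run q (S s) c = run q s (step (q (arg2 c)) c).
Proof. apply (run_add q 1 s c). Qed.

Lemma run_out_mono q s t c v : s <= t -> out (run q s c) = S v -> out (run q t c) = S v.
Proof.
  intros Hle H. induction Hle as [|t Hle IH]; [assumption |].
  rewrite run_S. now rewrite (step_halted _ _ v IH).
Qed.

Lemma eval_steps_mono q s t e x v :
  s <= t -> eval_steps q s e x = S v -> eval_steps q t e x = S v.
Proof. apply run_out_mono. Qed.

Lemma eval_steps_det q s t e x v w :
  eval_steps q s e x = S v -> eval_steps q t e x = S w -> v = w.
Proof.
  intros H1 H2. apply (eval_steps_mono q s (s + t)) in H1; [| lia].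
  apply (eval_steps_mono q t (s + t)) in H2; [| lia]. congruence.
Qed.

Ltac branch := unfold stepE, stepR; simpl Nat.eqb; cbv iota; proj.

Ltac decode_inv H :=
  match type of H with
  | decode ?e = _ =>
      let T := fresh "T" in
      rewrite decode_eq in H; cbv zeta in H;
      destruct (e mod 10) as [|[|[|[|[|[|[|[|[|?]]]]]]]]] eqn:T; try discriminate H
  end.

Definition reach q c c' := exists s, run q s c = c'.

Lemma reach_refl q c : reach q c c.
Proof. now exists 0. Qed.

Lemma reach_trans q c c' c'' : reach q c c' -> reach q c' c'' -> reach q c c''.
Proof. intros [s <-] [t <-]. exists (s + t). apply run_add. Qed.

Lemma reach_E q e x K c :
  reach q (stepE (q x) e (e mod 10) (e / 10) x K) c -> reach q (mkE e x K) c.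
Proof. intros [s <-]. exists (S s). now rewrite run_1, arg2_E, step_E. Qed.

Lemma reach_R q v fr K c :
  reach q (stepR v (fst_of fr) (snd_of fr) K) c -> reach q (mkR v (push fr K)) c.
Proof. intros [s <-]. exists (S s). now rewrite run_1, step_R. Qed.

Definition bit01 (b : bool) := if b then 1 else 0.

(* The second clause is the invariant of a primitive recursion: iterating up
   to a target [k] passes through the values at all smaller arguments. *)
Definition simulates q e x y :=
  (forall K, reach q (mkE e x K) (mkR y K)) /\
  (e mod 10 = 8 -> forall K k, snd_of x <= k ->
     reach q
       (mkE (fst_of (e / 10)) (fst_of x)
          (push (FRec (snd_of (e / 10)) (fst_of x) k 0) K))
       (mkR y (push (FRec (snd_of (e / 10)) (fst_of x) k (snd_of x)) K))).

Lemma simulates_rec q e x y : e mod 10 = 8 ->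
  (forall K k, snd_of x <= k ->
     reach q
       (mkE (fst_of (e / 10)) (fst_of x)
          (push (FRec (snd_of (e / 10)) (fst_of x) k 0) K))
       (mkR y (push (FRec (snd_of (e / 10)) (fst_of x) k (snd_of x)) K))) ->
  simulates q e x y.
Proof.
  intros T H. split; [| auto]. intros K. apply reach_E. rewrite T. branch.
  eapply reach_trans; [now apply H |]. apply reach_R. unfold FRec. proj.
  branch. unfold stepRec. rewrite Nat.leb_refl. apply reach_refl.
Qed.

(** The number [u] is a use: agreement of [q] with the oracle below [u] is enough. The induction is
    on the evaluation of a code, while the machine works with indices; as many indices decode to the
    same code, all of them are treated at once. *)
Lemma machine_complete O c x y : evalR O c x y ->
  exists u, forall q, (forall z, z < u -> q z = S (bit01 (O z))) ->
    forall e, decode e = c -> simulates q e x y.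
Proof.
  intros H.
  induction H as [x|x|x|x|x|x|f g x y z [u1 IH1] [u2 IH2]|f g x y z [u1 IH1] [u2 IH2]
                 |f g x y [u1 IH1]|f g x k y z [u1 IH1] [u2 IH2]|f x n [u1 IH1] IH2]
    using evalR_nested_ind.
  1-5: exists 0; intros q _ e He; decode_inv He; split; [| congruence]; intros K;
    apply reach_E; rewrite T; apply reach_refl.
  - exists (S x). intros q Hq e He. decode_inv He. split; [| congruence]. intros K.
    apply reach_E. rewrite T, Hq by lia. apply reach_refl.
  - exists (u1 + u2). intros q Hq e He. decode_inv He. injection He as Hf Hg.
    split; [| congruence]. intros K. apply reach_E. rewrite T.
    eapply reach_trans; [apply IH1; [| exact Hg]; intros; apply Hq; lia |].
    apply reach_R. unfold FComp. proj.
    apply IH2; [| exact Hf]. intros; apply Hq; lia.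
  - exists (u1 + u2). intros q Hq e He. decode_inv He. injection He as Hf Hg.
    split; [| congruence]. intros K. apply reach_E. rewrite T.
    eapply reach_trans; [apply IH1; [| exact Hf]; intros; apply Hq; lia |].
    apply reach_R. unfold FPair1. proj. branch.
    eapply reach_trans; [apply IH2; [| exact Hg]; intros; apply Hq; lia |].
    apply reach_R. unfold FPair2. proj. apply reach_refl.
  - exists u1. intros q Hq e He. decode_inv He. injection He as Hf Hg.
    apply simulates_rec; [exact T |]. proj. intros K k _. now apply IH1.
  - exists (u1 + u2). intros q Hq e He. decode_inv He.
    apply simulates_rec; [exact T |]. proj. intros K l Hl.
    destruct (IH1 q ltac:(intros; apply Hq; lia) e) as [_ IH].
    { rewrite decode_eq, T. exact He. }
    specialize (IH T K l). rewrite fst_pair, snd_pair in IH.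
    eapply reach_trans; [apply IH; lia |].
    apply reach_R. unfold FRec at 1 2. proj. branch. unfold stepRec.
    destruct (Nat.leb_spec l k); [lia |].
    injection He as Hf Hg. apply IH2; [| exact Hg]. intros; apply Hq; lia.
  (* The finitely many failing tests of the search need a common use; the sum of their uses
     serves. *)
  - assert (Hu : exists u, forall q, (forall z, z < u -> q z = S (bit01 (O z))) ->
      forall e, decode e = f -> forall m, m < n -> exists v, v <> 0 /\
        forall K, reach q (mkE e (pair x m) K) (mkR v K)).
    { clear IH1. induction n as [|n IHn]; [exists 0; lia |].
      destruct IHn as [u IHn]; [intros; apply IH2; lia |].
      destruct (IH2 n (Nat.lt_succ_diag_r n)) as (v & Hv & u' & Hu').
      exists (u + u'). intros q Hq e He m Hm.
      destruct (Nat.eq_dec m n) as [-> |].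
      - exists v. split; [assumption |]. apply Hu'; [| assumption]. intros; apply Hq; lia.
      - apply IHn; [| assumption | lia]. intros; apply Hq; lia. }
    destruct Hu as [u2 Hu]. exists (u1 + u2). intros q Hq e He.
    decode_inv He. injection He as Hf. split; [| congruence].
    intros K. apply reach_E. rewrite T. branch.
    assert (Hm : forall m, m <= n ->
      reach q (mkE (e / 10) (pair x 0) (push (FMu (e / 10) x 0) K))
              (mkE (e / 10) (pair x m) (push (FMu (e / 10) x m) K))).
    { induction m as [|m IHm]; intros Hm; [apply reach_refl |].
      eapply reach_trans; [apply IHm; lia |].
      destruct (Hu q ltac:(intros; apply Hq; lia) _ Hf m Hm) as (v & Hv & Hr).
      eapply reach_trans; [apply Hr |]. apply reach_R. unfold FMu at 1 2. proj.
      branch. unfold stepMu.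
      destruct (Nat.eqb_spec v 0); [easy |]. apply reach_refl. }
    eapply reach_trans; [now apply Hm |].
    eapply reach_trans; [apply IH1; [| exact Hf]; intros; apply Hq; lia |].
    apply reach_R. unfold FMu. proj. branch. apply reach_refl.
Qed.

Definition full (O : nat -> bool) : nat -> nat := fun z => S (bit01 (O z)).

Lemma Phi_use O e x y : Phi O e x y ->
  exists u, forall q, (forall z, z < u -> q z = full O z) ->
    exists s, eval_steps q s e x = S y.
Proof.
  intros H. destruct (machine_complete _ _ _ _ H) as [u Hu]. exists u. intros q Hq.
  destruct (Hu q Hq e eq_refl) as [Hr _]. destruct (Hr 0) as [s Hs].
  exists s. unfold eval_steps. now rewrite Hs, out_R.
Qed.

Lemma Phi_steps O e x y : Phi O e x y -> exists s, eval_steps (full O) s e x = S y.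
Proof. intros H. destruct (Phi_use _ _ _ _ H) as [u Hu]. now apply Hu. Qed.

Lemma run_peel q s c v : out (run q s c) = S v -> out c = 0 ->
  exists s', s = S s' /\ out (run q s' (step (q (arg2 c)) c)) = S v.
Proof.
  intros H Hc. destruct s as [|s]; [cbn in H; congruence |].
  exists s. now rewrite <- run_1.
Qed.

Lemma run_rest q s s1 c c' v : out (run q s c) = S v -> run q s1 c = c' -> s1 <= s ->
  out (run q (s - s1) c') = S v.
Proof. intros H <- Hle. rewrite <- run_add. now replace (s1 + (s - s1)) with s by lia. Qed.

Lemma peel_E q s e x K v : out (run q s (mkE e x K)) = S v ->
  exists s', s = S s' /\
    out (run q s' (stepE (q x) e (e mod 10) (e / 10) x K)) = S v.
Proof.
  intros H. destruct (run_peel _ _ _ _ H (out_E _ _ _)) as (s' & -> & H').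
  exists s'. split; [reflexivity |]. now rewrite arg2_E, step_E in H'.
Qed.

Lemma peel_R q s w fr K v : out (run q s (mkR w (push fr K))) = S v ->
  exists s', s = S s' /\ out (run q s' (stepR w (fst_of fr) (snd_of fr) K)) = S v.
Proof.
  intros H. destruct (run_peel _ _ _ _ H (out_push _ _ _)) as (s' & -> & H').
  exists s'. split; [reflexivity |]. now rewrite step_R in H'.
Qed.

(** * Soundness of the machine for partial oracle answers *)

Section Sound.
  Variables (O : nat -> bool) (q : nat -> nat).
  Hypothesis Hq : forall z b, q z = S b -> b = bit01 (O z).

  Definition returns (s c : nat) (K : nat) (Q : nat -> Prop) :=
    exists y s1, s1 <= s /\ run q s1 c = mkR y K /\ Q y.

  (** Soundness is proved by induction on the number of steps, for all stacks: a run that halts with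
      empty stack must first come back to [K], and every subevaluation has strictly fewer steps
      left. *)
  Definition sound_upto n := forall s e x K v, s < n ->
    out (run q s (mkE e x K)) = S v -> returns s (mkE e x K) K (evalR O (decode e) x).

  Lemma returns_E s e x K Q :
    returns s (stepE (q x) e (e mod 10) (e / 10) x K) K Q ->
    returns (S s) (mkE e x K) K Q.
  Proof.
    intros (y & s1 & H1 & H2 & H3). exists y, (S s1). rewrite run_1, arg2_E, step_E.
    repeat split; auto; lia.
  Qed.

  Lemma returns_R s w fr K Q :
    returns s (stepR w (fst_of fr) (snd_of fr) K) K Q ->
    returns (S s) (mkR w (push fr K)) K Q.
  Proof.
    intros (y & s1 & H1 & H2 & H3). exists y, (S s1). rewrite run_1, step_R.
    repeat split; auto; lia.
  Qed.

  Lemma returns_after s s1 c c' K Q :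
    run q s1 c = c' -> s1 <= s -> returns (s - s1) c' K Q -> returns s c K Q.
  Proof.
    intros E Hle (y & s2 & H1 & H2 & H3). exists y, (s1 + s2).
    rewrite run_add, E. repeat split; auto; lia.
  Qed.

  Lemma returns_impl s c K (Q Q' : nat -> Prop) :
    (forall y, Q y -> Q' y) -> returns s c K Q -> returns s c K Q'.
  Proof. intros HQ (y & s1 & ? & ? & ?). exists y, s1. auto. Qed.

  Lemma sound_rec n f g x k K : sound_upto n ->
    forall j i y s v, k = i + j -> s <= n -> evalR O (CRec f (decode g)) (pair x i) y ->
    out (run q s (mkR y (push (FRec g x k i) K))) = S v ->
    returns s (mkR y (push (FRec g x k i) K)) K (evalR O (CRec f (decode g)) (pair x k)).
  Proof.
    intros IH. induction j as [|j IHj]; intros i y s v Hk Hs Hy H;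
      destruct (peel_R _ _ _ _ _ _ H) as (s' & -> & H'); apply returns_R;
      revert H'; unfold FRec at 1 2 3 4; proj; branch;
      unfold stepRec; destruct (Nat.leb_spec k i); try lia; intros H'.
    - exists y, 0. replace k with i by lia. repeat split; auto; lia.
    - destruct (IH s' _ _ _ _ ltac:(lia) H') as (z & s1 & Hs1 & Hr & Hz).
      eapply returns_after; [exact Hr | exact Hs1 |].
      eapply IHj; [lia | lia | eapply eRecS; eassumption |].
      eapply run_rest; eassumption.
  Qed.

  Lemma sound_mu n f x K : sound_upto n ->
    forall s m y v, s <= n -> evalR O (decode f) (pair x m) y ->
    (forall l, l < m -> exists v, v <> 0 /\ evalR O (decode f) (pair x l) v) ->
    out (run q s (mkR y (push (FMu f x m) K))) = S v ->
    returns s (mkR y (push (FMu f x m) K)) K (evalR O (CMu (decode f)) x).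
  Proof.
    intros IH s. induction s as [s IHs] using lt_wf_ind. intros m y v Hs Hy Hm H.
    destruct (peel_R _ _ _ _ _ _ H) as (s' & -> & H'). apply returns_R.
    revert H'. unfold FMu at 1 2 3 4. proj. branch.
    unfold stepMu. destruct (Nat.eqb_spec y 0) as [-> | Hy0]; intros H'.
    - exists m, 0. repeat split; [lia | now apply eMu].
    - destruct (IH s' _ _ _ _ ltac:(lia) H') as (z & s1 & Hs1 & Hr & Hz).
      eapply returns_after; [exact Hr | exact Hs1 |].
      eapply IHs; [lia | lia | exact Hz | | eapply run_rest; eassumption].
      intros l Hl. destruct (Nat.eq_dec l m) as [-> |]; [eauto | apply Hm; lia].
  Qed.

  Lemma machine_sound n : sound_upto n.
  Proof.
    induction n as [|n IH]; intros s e x K v Hs H; [lia |].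
    destruct (peel_E _ _ _ _ _ _ H) as (s' & -> & H'). apply returns_E.
    rewrite decode_eq. cbv zeta. unfold stepE in *.
    destruct (e mod 10) as [|[|[|[|[|[|[|[|[|t]]]]]]]]] eqn:T;
      simpl Nat.eqb in *; cbv iota in *.
    1-5: eexists _, 0; repeat split; [lia | constructor].
    - destruct (Nat.eqb_spec (q x) 0) as [| Hx].
      (* A stuck query reproduces its own configuration, with one step less to go. *)
      + destruct (IH s' _ _ _ _ ltac:(lia) H') as (y & s1 & Hs1 & Hr & Hy).
        rewrite decode_eq, T in Hy. exists y, s1. auto.
      + destruct (q x) as [|b] eqn:Eb; [easy |]. apply Hq in Eb. subst b.
        eexists _, 0. repeat split; [lia | apply eOrc].
    - destruct (IH s' _ _ _ _ ltac:(lia) H') as (y & s1 & Hs1 & Hr & Hy).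
      eapply returns_after; [exact Hr | exact Hs1 |].
      pose proof (run_rest _ _ _ _ _ _ H' Hr Hs1) as H2.
      destruct (peel_R _ _ _ _ _ _ H2) as (s2 & E2 & H3). rewrite E2. apply returns_R.
      revert H3. unfold FComp. proj. branch. intros H3.
      eapply returns_impl; [| eapply IH; [lia | exact H3]].
      intros z Hz. eapply eComp; eassumption.
    - destruct (IH s' _ _ _ _ ltac:(lia) H') as (y & s1 & Hs1 & Hr & Hy).
      eapply returns_after; [exact Hr | exact Hs1 |].
      pose proof (run_rest _ _ _ _ _ _ H' Hr Hs1) as H2.
      destruct (peel_R _ _ _ _ _ _ H2) as (s2 & E2 & H3). rewrite E2. apply returns_R.
      revert H3. unfold FPair1. proj. branch. intros H3.
      destruct (IH s2 _ _ _ _ ltac:(lia) H3) as (z & s3 & Hs3 & Hr3 & Hz).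
      eapply returns_after; [exact Hr3 | exact Hs3 |].
      pose proof (run_rest _ _ _ _ _ _ H3 Hr3 Hs3) as H4.
      destruct (peel_R _ _ _ _ _ _ H4) as (s4 & E4 & H5). rewrite E4. apply returns_R.
      unfold FPair2. proj. exists (pair y z), 0.
      repeat split; [lia | constructor; assumption].
    - destruct (IH s' _ _ _ _ ltac:(lia) H') as (y & s1 & Hs1 & Hr & Hy).
      eapply returns_after; [exact Hr | exact Hs1 |].
      apply (returns_impl _ _ _ (evalR O (CRec (decode (fst_of (e / 10)))
        (decode (snd_of (e / 10)))) (pair (fst_of x) (snd_of x))));
        [now rewrite pair_eta |].
      eapply (sound_rec n _ _ _ _ _ IH (snd_of x));
        [reflexivity | lia | apply eRec0, Hy |].
      eapply run_rest; eassumption.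
    - destruct (IH s' _ _ _ _ ltac:(lia) H') as (y & s1 & Hs1 & Hr & Hy).
      eapply returns_after; [exact Hr | exact Hs1 |].
      eapply (sound_mu n _ _ _ IH); [lia | exact Hy | lia |].
      eapply run_rest; eassumption.
  Qed.

  Lemma eval_steps_sound s e x v : eval_steps q s e x = S v -> Phi O e x v.
  Proof.
    intros H. destruct (machine_sound (S s) s e x 0 v ltac:(lia) H)
      as (y & s1 & Hs1 & Hr & Hy).
    pose proof (run_rest _ _ _ _ _ _ H Hr Hs1) as H2.
    assert (E : out (run q s1 (mkE e x 0)) = S y) by now rewrite Hr, out_R.
    apply (run_out_mono _ _ s) in E; [| assumption].
    unfold eval_steps in H. rewrite E in H. injection H as ->. exact Hy.
  Qed.
End Sound.

Lemma Phi_fun O e x y z : Phi O e x y -> Phi O e x z -> y = z.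
Proof.
  intros [s Hs]%Phi_steps [t Ht]%Phi_steps. eapply eval_steps_det; eassumption.
Qed.

(** * Computable functions *)

Definition cpt (O : nat -> bool) (f : nat -> nat) :=
  exists c, forall x, evalR O c x (f x).

Definition cptb (O : nat -> bool) (b : nat -> bool) := cpt O (fun x => bit01 (b x)).

(* least [i < n] with [P i], or [n] *)
Definition bmin (P : nat -> bool) (n : nat) : nat :=
  prec 0 (fun _ acc => if P acc then acc else S acc) n.

Lemma bmin_le P n : bmin P n <= n.
Proof.
  unfold bmin. induction n as [|n IH]; simpl; [lia |].
  destruct (P _); lia.
Qed.

Lemma bmin_before P n i : i < bmin P n -> P i = false.
Proof.
  unfold bmin. induction n as [|n IH]; simpl; [lia |].
  destruct (P (prec _ _ n)) eqn:E; [exact IH |]. intros H.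
  destruct (Nat.eq_dec i (prec 0 (fun _ acc => if P acc then acc else S acc) n)) as [-> |];
    [exact E | apply IH; lia].
Qed.

Lemma bmin_found P n : bmin P n < n -> P (bmin P n) = true.
Proof.
  unfold bmin. induction n as [|n IH]; simpl; [lia |].
  destruct (P (prec _ _ n)) eqn:E; [now intros _ |].
  intros H. discriminate IH. lia.
Qed.

Lemma bmin_least P n i : P i = true -> bmin P n <= i.
Proof.
  intros H. destruct (Nat.le_gt_cases (bmin P n) i) as [|Hlt]; [assumption |].
  apply bmin_before in Hlt. congruence.
Qed.

Lemma bmin_eq P n i : i <= n -> (forall j, j < i -> P j = false) ->
  (i < n -> P i = true) -> bmin P n = i.
Proof.
  intros Hi H1 H2. pose proof (bmin_le P n).
  destruct (Nat.lt_trichotomy (bmin P n) i) as [Hlt | [He | Hgt]]; [| assumption |].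
  - pose proof (bmin_found P n ltac:(lia)). rewrite H1 in H0 by assumption. discriminate.
  - pose proof (bmin_before P n i Hgt). rewrite H2 in H0 by lia. discriminate.
Qed.

Section Cpt.
  Variable O : nat -> bool.
  Local Notation cpt := (cpt O).
  Local Notation cptb := (cptb O).

  Lemma cpt_ext f g : (forall x, f x = g x) -> cpt f -> cpt g.
  Proof. intros H [c Hc]. exists c. intros x. rewrite <- H. apply Hc. Qed.

  Lemma cpt_id : cpt (fun x => x).
  Proof. exists CId. intros; apply eId. Qed.

  Lemma cpt_comp f g : cpt f -> cpt g -> cpt (fun x => f (g x)).
  Proof. intros [c Hc] [d Hd]. exists (CComp c d). intros x. eapply eComp; auto. Qed.

  Lemma cpt_S f : cpt f -> cpt (fun x => S (f x)).
  Proof. apply (cpt_comp S). exists CSucc. intros; apply eSucc. Qed.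

  Lemma cpt_const k : cpt (fun _ => k).
  Proof.
    induction k as [|k IH]; [exists CZero; intros; apply eZero | now apply cpt_S].
  Qed.

  Lemma cpt_fst f : cpt f -> cpt (fun x => fst_of (f x)).
  Proof. apply (cpt_comp fst_of). exists CFst. intros; apply eFst. Qed.

  Lemma cpt_snd f : cpt f -> cpt (fun x => snd_of (f x)).
  Proof. apply (cpt_comp snd_of). exists CSnd. intros; apply eSnd. Qed.

  Lemma cpt_pair f g : cpt f -> cpt g -> cpt (fun x => pair (f x) (g x)).
  Proof. intros [c Hc] [d Hd]. exists (CPair c d). intros; apply ePair; auto. Qed.

  Lemma cpt_oracle f : cpt f -> cptb (fun x => O (f x)).
  Proof. apply (cpt_comp (fun z => bit01 (O z))). exists COrc. intros; apply eOrc. Qed.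

  Lemma cpt_prec (n b : nat -> nat) (st : nat -> nat -> nat -> nat) :
    cpt n -> cpt b ->
    cpt (fun p => st (fst_of p) (fst_of (snd_of p)) (snd_of (snd_of p))) ->
    cpt (fun x => prec (b x) (st x) (n x)).
  Proof.
    intros [cn Hn] [cb Hb] [cs Hs].
    exists (CComp (CRec cb cs) (CPair CId cn)). intros x.
    eapply eComp; [apply ePair; [apply eId | apply Hn] |].
    induction (n x) as [|k IH]; [apply eRec0, Hb |].
    eapply eRecS; [exact IH |].
    specialize (Hs (pair x (pair k (prec (b x) (st x) k)))).
    now rewrite !snd_pair, !fst_pair in Hs.
  Qed.

  Lemma cpt_natcase n a b : cpt n -> cpt a ->
    cpt (fun p => b (fst_of p) (snd_of p)) ->
    cpt (fun x => match n x with 0 => a x | S m => b x m end).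
  Proof.
    intros Hn Ha Hb.
    apply (cpt_ext (fun x => prec (a x) (fun k _ => b x k) (n x))).
    { intros x. now destruct (n x). }
    apply (cpt_prec n a (fun x k _ => b x k)); auto.
    apply (cpt_ext (fun p => b (fst_of (pair (fst_of p) (fst_of (snd_of p))))
                               (snd_of (pair (fst_of p) (fst_of (snd_of p)))))).
    { intros p. now rewrite fst_pair, snd_pair. }
    apply (cpt_comp (fun p => b (fst_of p) (snd_of p))); [assumption |].
    apply cpt_pair; repeat first [apply cpt_fst | apply cpt_snd]; apply cpt_id.
  Qed.

  Lemma cpt_pred f : cpt f -> cpt (fun x => pred (f x)).
  Proof.
    intros H. apply (cpt_ext (fun x => match f x with 0 => 0 | S m => m end)).
    { intros x. now destruct (f x). }
    apply (cpt_natcase f (fun _ => 0) (fun _ m => m)); auto using cpt_const.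
    apply cpt_snd, cpt_id.
  Qed.

  Lemma cpt_if b f g : cptb b -> cpt f -> cpt g -> cpt (fun x => if b x then f x else g x).
  Proof.
    intros Hb Hf Hg.
    apply (cpt_ext (fun x => match bit01 (b x) with 0 => g x | S m => f x end)).
    { intros x. now destruct (b x). }
    apply (cpt_natcase (fun x => bit01 (b x)) g (fun x _ => f x)); auto.
    apply (cpt_comp f); [assumption | apply cpt_fst, cpt_id].
  Qed.

  Lemma cpt_bit b : cptb b -> cpt (fun x => bit01 (b x)).
  Proof. easy. Qed.

  Lemma cpt_add f g : cpt f -> cpt g -> cpt (fun x => f x + g x).
  Proof.
    intros Hf Hg. apply (cpt_ext (fun x => prec (f x) (fun _ y => S y) (g x))).
    { intros x. induction (g x) as [|k IH]; simpl; lia. }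
    apply (cpt_prec g f (fun _ _ y => S y)); auto. apply cpt_S, cpt_snd, cpt_snd, cpt_id.
  Qed.

  Lemma cpt_sub f g : cpt f -> cpt g -> cpt (fun x => f x - g x).
  Proof.
    intros Hf Hg. apply (cpt_ext (fun x => prec (f x) (fun _ y => pred y) (g x))).
    { intros x. induction (g x) as [|k IH]; simpl; lia. }
    apply (cpt_prec g f (fun _ _ y => pred y)); auto.
    apply cpt_pred, cpt_snd, cpt_snd, cpt_id.
  Qed.

  Lemma cpt_mul f g : cpt f -> cpt g -> cpt (fun x => f x * g x).
  Proof.
    intros Hf Hg. apply (cpt_ext (fun x => prec 0 (fun _ y => y + f x) (g x))).
    { intros x. induction (g x) as [|k IH]; simpl; lia. }
    apply (cpt_prec g (fun _ => 0) (fun x _ y => y + f x)); auto using cpt_const.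
    apply cpt_add; [apply cpt_snd, cpt_snd, cpt_id |].
    apply (cpt_comp f); [assumption | apply cpt_fst, cpt_id].
  Qed.

  Lemma cpt_leb f g : cpt f -> cpt g -> cptb (fun x => f x <=? g x).
  Proof.
    intros Hf Hg. apply (cpt_ext (fun x => 1 - (f x - g x))).
    { intros x. destruct (Nat.leb_spec (f x) (g x)); cbn [bit01]; lia. }
    apply cpt_sub; [apply cpt_const | now apply cpt_sub].
  Qed.

  Lemma cpt_ltb f g : cpt f -> cpt g -> cptb (fun x => f x <? g x).
  Proof. intros Hf Hg. apply (cpt_leb (fun x => S (f x))); auto using cpt_S. Qed.

  Lemma cpt_andb b c : cptb b -> cptb c -> cptb (fun x => b x && c x)%bool.
  Proof.
    intros Hb Hc. apply (cpt_ext (fun x => if b x then bit01 (c x) else 0)).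
    { intros x. now destruct (b x). }
    apply cpt_if; auto using cpt_const, cpt_bit.
  Qed.

  Lemma cpt_negb b : cptb b -> cptb (fun x => negb (b x)).
  Proof.
    intros Hb. apply (cpt_ext (fun x => if b x then 0 else 1)).
    { intros x. now destruct (b x). }
    apply cpt_if; auto using cpt_const.
  Qed.

  Lemma cpt_eqb f g : cpt f -> cpt g -> cptb (fun x => f x =? g x).
  Proof.
    intros Hf Hg. apply (cpt_ext (fun x => bit01 ((f x <=? g x) && (g x <=? f x)))).
    { intros x. f_equal. apply Bool.eq_iff_eq_true.
      rewrite Bool.andb_true_iff, !Nat.leb_le, Nat.eqb_eq. lia. }
    apply cpt_andb; now apply cpt_leb.
  Qed.

  Lemma cpt_bmin P n : cptb (fun p => P (fst_of p) (snd_of p)) -> cpt n ->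
    cpt (fun x => bmin (P x) (n x)).
  Proof.
    intros HP Hn. unfold bmin.
    apply (cpt_prec n (fun _ => 0) (fun x _ acc => if P x acc then acc else S acc));
      auto using cpt_const.
    assert (Hacc : cpt (fun p => snd_of (snd_of p))) by apply cpt_snd, cpt_snd, cpt_id.
    apply cpt_if; auto using cpt_S.
    apply (cpt_ext (fun p => bit01 (P (fst_of (pair (fst_of p) (snd_of (snd_of p))))
                               (snd_of (pair (fst_of p) (snd_of (snd_of p))))))).
    { intros p. now rewrite fst_pair, snd_pair. }
    apply (cpt_comp (fun p => bit01 (P (fst_of p) (snd_of p)))); [assumption |].
    apply cpt_pair; auto. apply cpt_fst, cpt_id.
  Qed.

  Lemma cpt_comp2 (f : nat -> nat -> nat) a b :
    cpt (fun p => f (fst_of p) (snd_of p)) -> cpt a -> cpt b ->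
    cpt (fun x => f (a x) (b x)).
  Proof.
    intros Hf Ha Hb.
    apply (cpt_ext (fun x => f (fst_of (pair (a x) (b x))) (snd_of (pair (a x) (b x))))).
    { intros x. now rewrite fst_pair, snd_pair. }
    apply (cpt_comp (fun p => f (fst_of p) (snd_of p))); [assumption |].
    now apply cpt_pair.
  Qed.
End Cpt.

Ltac cpt_unify :=
  first
    [ assumption
    | simple apply cpt_id | simple apply cpt_const
    | simple apply cpt_S | simple apply cpt_fst | simple apply cpt_snd
    | simple apply cpt_pair | simple apply cpt_prec
    | simple apply cpt_if | simple apply cpt_bit | simple apply cpt_add
    | simple apply cpt_sub | simple apply cpt_mul | simple apply cpt_pred
    | simple apply cpt_leb | simple apply cpt_ltb | simple apply cpt_eqb
    | simple apply cpt_andb | simple apply cpt_negb | simple apply cpt_bmin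
    | simple apply cpt_natcase
    ].
Ltac cpt_extra := fail.
Ltac cpt := repeat (cbv beta; first [cpt_unify | cpt_extra]).

Lemma cpt_div O f g : cpt O f -> cpt O g -> cpt O (fun x => f x / g x).
Proof.
  intros Hf Hg.
  apply (cpt_ext O (fun x => if g x =? 0 then 0
                             else bmin (fun k => f x <? S k * g x) (f x))).
  - intros x. destruct (Nat.eqb_spec (g x) 0) as [-> | H]; [now destruct (f x) |].
    apply bmin_eq.
    + apply Nat.Div0.div_le_upper_bound; nia.
    + intros j Hj. apply Nat.ltb_ge.
      pose proof (Nat.Div0.mul_div_le (f x) (g x)). nia.
    + intros _. apply Nat.ltb_lt. rewrite Nat.mul_comm. now apply Nat.mul_succ_div_gt.
  - assert (cpt O (fun p => f (fst_of p))) by (apply (cpt_comp O f); cpt).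
    assert (cpt O (fun p => g (fst_of p))) by (apply (cpt_comp O g); cpt).
    cpt.
Qed.

Lemma cpt_mod O f g : cpt O f -> cpt O g -> cpt O (fun x => f x mod g x).
Proof.
  intros Hf Hg. apply (cpt_ext O (fun x => f x - g x * (f x / g x))).
  - intros x. symmetry. apply Nat.Div0.mod_eq.
  - apply cpt_sub, cpt_mul; auto using cpt_div.
Qed.

Lemma cpt_pow O f g : cpt O f -> cpt O g -> cpt O (fun x => f x ^ g x).
Proof.
  intros Hf Hg. apply (cpt_ext O (fun x => prec 1 (fun _ y => f x * y) (g x))).
  - intros x. now induction (g x) as [|k IH]; simpl; [| rewrite IH].
  - assert (cpt O (fun p => f (fst_of p))) by (apply (cpt_comp O f); cpt). cpt.
Qed.

Lemma cpt_fact O f : cpt O f -> cpt O (fun x => fact (f x)).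
Proof.
  intros Hf. apply (cpt_ext O (fun x => prec 1 (fun k y => S k * y) (f x))).
  - intros x. induction (f x) as [|k IH]; [reflexivity |]. cbn [prec]. now rewrite IH.
  - cpt.
Qed.

Ltac cpt_extra ::=
  first [ simple apply cpt_div | simple apply cpt_mod | simple apply cpt_pow
        | simple apply cpt_fact ].

Lemma cpt_step O a c : cpt O a -> cpt O c -> cpt O (fun x => step (a x) (c x)).
Proof.
  intros Ha Hc.
  unfold step, stepE, stepR, stepRec, stepMu, mkE, mkR, push, FComp, FPair1, FPair2,
    FRec, FMu, arg1, arg2, stack.
  cpt.
Qed.

Lemma cpt_eval_steps O q s e y :
  cpt O (fun p => q (fst_of p) (snd_of p)) -> cpt O s -> cpt O e -> cpt O y ->
  cpt O (fun x => eval_steps (q x) (s x) (e x) (y x)).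
Proof.
  intros Hq Hs He Hy. unfold eval_steps, out, arg1, stack.
  assert (Hr : cpt O (fun x => run (q x) (s x) (mkE (e x) (y x) 0))).
  { unfold run, mkE. apply cpt_prec; [assumption | cpt |].
    apply cpt_step; [| cpt]. unfold arg2.
    apply (cpt_comp2 O q); cpt. }
  cpt.
Qed.

Lemma cpt_computable f : cpt emptyO f <-> computable f.
Proof.
  split.
  - intros [c Hc]. destruct (decode_surj c) as [e <-]. now exists e.
  - intros [e He]. now exists (decode e).
Qed.

(** Under the empty oracle every query is answered [0]; putting this constant in place of queries
    makes the computation valid for all oracles. *)
Fixpoint no_oracle (c : code) : code :=
  match c with
  | COrc => CZero
  | CComp f g => CComp (no_oracle f) (no_oracle g)
  | CPair f g => CPair (no_oracle f) (no_oracle g)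
  | CRec f g => CRec (no_oracle f) (no_oracle g)
  | CMu f => CMu (no_oracle f)
  | c => c
  end.

Lemma evalR_no_oracle O c x y : evalR emptyO c x y -> evalR O (no_oracle c) x y.
Proof.
  intros H. induction H using evalR_nested_ind; simpl; econstructor; eassumption.
Qed.

Lemma computable_cpt O f : computable f -> cpt O f.
Proof.
  intros [e He]. exists (no_oracle (decode e)). intros x. apply evalR_no_oracle, He.
Qed.

(** * Counting mind changes by potentials *)

(* At most [k] events [C], in a form that adds up under unions. *)
Definition few (C : nat -> Prop) (k : nat) :=
  exists p : nat -> nat,
    (forall s, p s <= p (S s)) /\ (forall s, p s <= k) /\
    (forall s, C s -> p s < p (S s)).

Lemma mono_le (p : nat -> nat) : (forall s, p s <= p (S s)) ->
  forall s t, s <= t -> p s <= p t.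
Proof. intros H s t Hle. induction Hle as [|t _ IH]; [lia |]. specialize (H t). lia. Qed.

Lemma few_impl (C D : nat -> Prop) k l :
  (forall s, C s -> D s) -> k <= l -> few D k -> few C l.
Proof.
  intros H Hk (p & H1 & H2 & H3). exists p. repeat split; auto.
  intros s. specialize (H2 s). lia.
Qed.

Lemma few_or (C D : nat -> Prop) k l :
  few C k -> few D l -> few (fun s => C s \/ D s) (k + l).
Proof.
  intros (p & P1 & P2 & P3) (q & Q1 & Q2 & Q3). exists (fun s => p s + q s).
  repeat split; intros s; specialize (P1 s); specialize (P2 s);
    specialize (Q1 s); specialize (Q2 s); try lia.
  intros [H | H]; [apply P3 in H | apply Q3 in H]; lia.
Qed.

Lemma few_bex (C : nat -> nat -> Prop) B k : (forall i, i < B -> few (C i) k) ->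
  few (fun s => exists i, i < B /\ C i s) (B * k).
Proof.
  induction B as [|B IH]; intros H.
  - exists (fun _ => 0). repeat split; auto. intros s (i & Hi & _). lia.
  - apply (few_impl _ (fun s => C B s \/ exists i, i < B /\ C i s) (k + B * k)).
    + intros s (i & Hi & Hc). destruct (Nat.eq_dec i B) as [-> |]; [now left |].
      right. exists i. split; [lia | assumption].
    + simpl. lia.
    + apply few_or; auto.
Qed.

(* Lexicographic product: [f] may drop arbitrarily at an event in [C]. *)
Lemma few_reset (C D : nat -> Prop) k (f : nat -> nat) m : few C k ->
  (forall s, f s <= m) -> (forall s, C s \/ f s <= f (S s)) ->
  (forall s, D s -> C s \/ f s < f (S s)) ->
  few (fun s => C s \/ D s) (k * S m + m).
Proof.
  intros (p & P1 & P2 & P3) F1 F2 F3. exists (fun s => p s * S m + f s).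
  repeat split; intros s; pose proof (P1 s); pose proof (P2 s); pose proof (F1 s);
    pose proof (F1 (S s)).
  - destruct (F2 s) as [Hc | Hc]; [apply P3 in Hc |]; nia.
  - nia.
  - intros [Hc | Hd]; [apply P3 in Hc; nia |].
    destruct (F3 s Hd) as [Hc | Hc]; [apply P3 in Hc |]; nia.
Qed.

Lemma few_stable C k : few C k -> exists t0, forall t, t0 <= t -> ~ C t.
Proof.
  intros (p & P1 & P2 & P3).
  (* Induction on the potential still available at stage [s], which every further event
     diminishes. *)
  assert (H : forall j s, k - p s <= j -> exists t0, forall t, t0 <= t -> ~ C t).
  { induction j as [|j IH]; intros s Hj.
    - exists s. intros t Ht Hc. apply P3 in Hc. pose proof (mono_le p P1 s t Ht).
      pose proof (P2 (S t)). lia.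
    - destruct (classic (exists t, s <= t /\ C t)) as [(t & Ht & Hc) | Hn].
      + apply (IH (S t)). apply P3 in Hc. pose proof (mono_le p P1 s t Ht).
        pose proof (P2 (S t)). lia.
      + exists s. intros t Ht Hc. apply Hn. eauto. }
  apply (H _ 0 (le_n _)).
Qed.

Lemma stable_const {X} (g : nat -> X) t0 :
  (forall t, t0 <= t -> ~ g t <> g (S t)) -> forall t, t0 <= t -> g t = g t0.
Proof.
  intros H t Ht. induction Ht as [|t Ht IH]; [reflexivity |].
  rewrite <- IH. symmetry. now apply NNPP, H.
Qed.

Lemma few_limit {X} (g : nat -> X) k : few (fun s => g s <> g (S s)) k ->
  exists t0, forall t, t0 <= t -> g t = g t0.
Proof.
  intros [t0 H]%few_stable. exists t0. now apply stable_const.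
Qed.

Lemma card_le_inj (Y : nat -> Prop) n (Q : nat -> nat -> Prop) :
  (forall y, Y y -> exists i, i < n /\ Q y i) ->
  (forall y y' i, Q y i -> Q y' i -> y = y') -> card_le Y n.
Proof.
  intros H1 H2 l Hnd Hl.
  assert (Hli : exists li, length li = length l /\ NoDup li /\
    (forall i, In i li -> i < n /\ exists y, In y l /\ Q y i)).
  { induction l as [|y l IH]; [exists []; repeat split; [constructor | easy..] |].
    inversion Hnd as [|? ? Hy Hnd']; subst.
    destruct IH as (li & E & Hli & Hi); [assumption | intros; apply Hl; now right |].
    destruct (H1 y) as (i & Hin & Hq); [apply Hl; now left |].
    exists (i :: li). repeat split; simpl; [lia | constructor; [| assumption] |..].
    - intros (_ & y' & Hy' & Hq')%Hi. now rewrite (H2 _ _ _ Hq Hq') in Hy.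
    - destruct H as [<- | H]; [assumption | now apply Hi].
    - destruct H as [<- | H]; [eauto |]. destruct (Hi _ H) as (_ & y' & ? & ?). eauto. }
  destruct Hli as (li & E & Hli & Hi). rewrite <- E, <- (length_seq n 0).
  apply NoDup_incl_length; [assumption |]. intros i H%Hi. apply in_seq. lia.
Qed.

Lemma few_card C k : few C k -> card_le C k.
Proof.
  intros (p & P1 & P2 & P3). apply (card_le_inj _ _ (fun s i => C s /\ i = p s)).
  - intros s Hs. exists (p s). apply P3 in Hs as Hlt. pose proof (P2 (S s)).
    repeat split; auto; lia.
  - intros s s' i [Hc ->] [Hc' E]. apply P3 in Hc, Hc'.
    destruct (Nat.lt_trichotomy s s') as [H | [H | H]]; [| assumption |];
      apply (mono_le p P1) in H; lia.
Qed.

(** A potential bounded by [k] takes at most [k + 1] values, and stages of equal potential have the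
    same [g q s]. Hence [q] and the potential, coded as [q * S k + p s], determine [y]. *)
Lemma few_values {X} (g : nat -> nat -> X) B k (R : X -> nat -> Prop) :
  (forall q, q < B -> few (fun s => g q s <> g q (S s)) k) ->
  (forall x y y', R x y -> R x y' -> y = y') ->
  card_le (fun y => exists q s, q < B /\ R (g q s) y) (B * S k).
Proof.
  intros Hf HR.
  assert (Hp : forall q, exists p : nat -> nat, q < B ->
    (forall s, p s <= k) /\ forall s t, p s = p t -> g q s = g q t).
  { intros q. destruct (classic (q < B)) as [Hq | Hq]; [| now exists (fun _ => 0)].
    destruct (Hf q Hq) as (p & P1 & P2 & P3). exists p. intros _. split; [assumption |].
    assert (H : forall s d, p s = p (s + d) -> g q s = g q (s + d)).
    { intros s d. induction d as [|d IH]; [now rewrite Nat.add_0_r |].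
      rewrite Nat.add_succ_r. intros E.
      pose proof (mono_le p P1 s (s + d) ltac:(lia)). pose proof (P1 (s + d)).
      rewrite IH by lia. apply NNPP. intros Hc%P3. lia. }
    intros s t E. destruct (Nat.le_ge_cases s t) as [Hle | Hle].
    - replace t with (s + (t - s)) in * by lia. now apply H.
    - symmetry. replace s with (t + (s - t)) in * by lia. now apply H. }
  apply (card_le_inj _ _ (fun y i => exists q s p, q < B /\ R (g q s) y /\
    p = proj1_sig (constructive_indefinite_description _ (Hp q)) /\ i = q * S k + p s)).
  - intros y (q & s & Hq & Hy).
    set (p := proj1_sig (constructive_indefinite_description _ (Hp q))).
    exists (q * S k + p s). split; [| exists q, s, p; auto].
    pose proof (proj2_sig (constructive_indefinite_description _ (Hp q)) Hq) as [H _].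
    fold p in H. specialize (H s). nia.
  - intros y y' i (q & s & p & Hq & Hy & Ep & ->) (q' & s' & p' & Hq' & Hy' & Ep' & E).
    pose proof (proj2_sig (constructive_indefinite_description _ (Hp q)) Hq) as [H1 H2].
    pose proof (proj2_sig (constructive_indefinite_description _ (Hp q')) Hq') as [H1' _].
    rewrite <- Ep in *. rewrite <- Ep' in *. pose proof (H1 s). pose proof (H1' s').
    assert (q = q') as <- by nia. rewrite <- Ep in Ep'. subst p'.
    eapply HR; [exact Hy |]. rewrite (H2 s s'); [assumption | nia].
Qed.

(** * The guesses against a single trace *)

(* Level [x = pair n k] with [n = pair c d] diagonalises at argument [n]
   against the [omega]-c.e. function approximated by the code [c] with change
   bound computed by [d], as long as its trace at [n] has at most [k] elements. *)

Definition eval0 s e x := eval_steps (full emptyO) s e x.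

(* successor of the value of the change bound, [0] while it is not computed *)
Definition bound_val s x := eval0 s (snd_of (fst_of x)) (fst_of x).

(* upper bound for the number of changes of the guess at level [x] *)
Definition cap s x := 2 * bound_val s x * S (snd_of x).

(* State: number [t] of values of the approximation computed so far, successor
   of the last one, and number of its changes, which is capped by [bound_val]. *)
Definition approx_step x s st :=
  if bound_val s x =? 0 then st
  else if eval0 s (fst_of (fst_of x)) (pair (fst_of x) (fst_of st)) =? 0 then st
  else if eval0 s (fst_of (fst_of x)) (pair (fst_of x) (fst_of st)) =? fst_of (snd_of st)
  then pair (S (fst_of st)) (snd_of st)
  else if snd_of (snd_of st) <? bound_val s x
  then pair (S (fst_of st))
         (pair (eval0 s (fst_of (fst_of x)) (pair (fst_of x) (fst_of st)))
               (S (snd_of (snd_of st))))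
  else pair (S (fst_of st)) (snd_of st).

Definition approx s x := prec (pair 0 (pair 0 0)) (approx_step x) s.
Definition ap_time s x := fst_of (approx s x).
Definition ap_val s x := fst_of (snd_of (approx s x)).
Definition ap_count s x := snd_of (snd_of (approx s x)).

(** The least number below [k = snd_of x] not yet enumerated into the candidate trace, and [k] by
    default: a trace of size at most [k] containing all numbers below [k] cannot contain [k]. *)
Definition guess s x :=
  if ap_val s x =? 0 then 0
  else bmin (fun j => eval0 s (pred (ap_val s x)) j =? 0) (snd_of x).

Lemma eval0_mono s e x : eval0 s e x = 0 \/ eval0 (S s) e x = eval0 s e x.
Proof.
  destruct (eval0 s e x) as [|v] eqn:E; [now left | right].
  eapply eval_steps_mono; [| exact E]. lia.
Qed.

Lemma approx_S s x : approx (S s) x = approx_step x s (approx s x).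
Proof. reflexivity. Qed.

Lemma approx_mono s x :
  (ap_count (S s) x = ap_count s x /\ ap_val (S s) x = ap_val s x) \/
  ap_count s x < ap_count (S s) x.
Proof.
  unfold ap_count, ap_val. rewrite approx_S. unfold approx_step.
  repeat match goal with |- context [if ?b then _ else _] => destruct b end;
    proj; auto.
Qed.

Lemma ap_time_mono s x : ap_time s x <= ap_time (S s) x.
Proof.
  unfold ap_time. rewrite approx_S. unfold approx_step.
  repeat match goal with |- context [if ?b then _ else _] => destruct b end;
    proj; auto.
Qed.

Lemma approx_inv s x :
  ap_count s x <= bound_val s x /\ (bound_val s x = 0 -> ap_val s x = 0).
Proof.
  induction s as [|s [IH1 IH2]].
  - unfold ap_count, ap_val, approx. cbn [prec]. proj. split; [lia | reflexivity].
  - destruct (eval0_mono s (snd_of (fst_of x)) (fst_of x)) as [H0 | H0];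
      fold (bound_val s x) in H0; try fold (bound_val (S s) x) in H0.
    + assert (E : approx (S s) x = approx s x).
      { rewrite approx_S. unfold approx_step. now rewrite H0. }
      unfold ap_count, ap_val in *. rewrite E. split; [lia |]. intros _. auto.
    + rewrite H0. unfold ap_count, ap_val in *. rewrite approx_S. unfold approx_step.
      destruct (Nat.eqb_spec (bound_val s x) 0); [auto |].
      split; [| lia].
      destruct (_ =? 0); [auto |]. destruct (_ =? _); [now proj |].
      destruct (Nat.ltb_spec (snd_of (snd_of (approx s x))) (bound_val s x)); now proj.
Qed.

Lemma guess_le s x : guess s x <= snd_of x.
Proof. unfold guess. destruct (_ =? 0); [lia | apply bmin_le]. Qed.

Lemma bound_val_mono s x : bound_val s x <= bound_val (S s) x.
Proof. destruct (eval0_mono s (snd_of (fst_of x)) (fst_of x)); unfold bound_val; lia. Qed.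

Lemma cap_mono s x : cap s x <= cap (S s) x.
Proof. pose proof (bound_val_mono s x). unfold cap. nia. Qed.

Lemma cap_flag s x : cap s x = 0 \/ cap (S s) x = cap s x.
Proof.
  unfold cap. destruct (eval0_mono s (snd_of (fst_of x)) (fst_of x)) as [H | H];
    unfold bound_val; rewrite H; auto.
Qed.

Lemma guess_mono s x :
  ap_val (S s) x = ap_val s x -> guess s x <= guess (S s) x.
Proof.
  intros E. unfold guess. rewrite E. destruct (_ =? 0); [lia |].
  set (P := fun j => eval0 (S s) (pred (ap_val s x)) j =? 0).
  destruct (Nat.le_gt_cases (snd_of x) (bmin P (snd_of x))) as [H | H].
  - etransitivity; [apply bmin_le | exact H].
  - apply bmin_least. apply bmin_found in H. unfold P at 1 in H.
    apply Nat.eqb_eq in H. apply Nat.eqb_eq.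
    destruct (eval0_mono s (pred (ap_val s x)) (bmin P (snd_of x))); lia.
Qed.

(** The potential is lexicographic: while the approximated value stays the same, its trace only
    grows and so does the guess; when the value changes, the guess may drop, but the count of
    changes goes up. *)
Lemma guess_potential x : exists p : nat -> nat,
  (forall s, p s <= p (S s)) /\ (forall s, p s <= cap s x) /\
  (forall s, guess s x <> guess (S s) x -> p s < p (S s)).
Proof.
  exists (fun s => ap_count s x * S (snd_of x) + guess s x).
  repeat split; intros s; pose proof (guess_le s x); pose proof (guess_le (S s) x).
  - destruct (approx_mono s x) as [[-> E] | H1]; [| nia].
    apply guess_mono in E. lia.
  (* Once [bound_val] is positive, the factor 2 in [cap] absorbs the summand [guess s x], which is
     at most [snd_of x]; before that, count and guess are [0]. *)
  - destruct (approx_inv s x) as [H1 H2]. unfold cap.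
    destruct (Nat.eq_dec (bound_val s x) 0) as [E | E]; [| nia].
    unfold guess in *. rewrite H2 in * by assumption. simpl. nia.
  - intros Hne. destruct (approx_mono s x) as [[-> E] | H1]; [| nia].
    apply guess_mono in E. lia.
Qed.

(** The cap jumps from [0] to its final value when the change bound converges, if it ever does;
    [min 1] records whether this has happened. *)
Lemma cap_few x : few (fun s => cap s x <> cap (S s) x) 1.
Proof.
  exists (fun s => Nat.min 1 (cap s x)). repeat split; intros s.
  - pose proof (cap_mono s x). lia.
  - lia.
  - destruct (cap_flag s x) as [H | H]; lia.
Qed.

(** This holds at every level, even if the codes describe no approximation: the final value of the
    cap, whatever it is, bounds the potential. *)
Lemma guess_limit x : exists t0, forall t, t0 <= t -> guess t x = guess t0 x.
Proof.
  destruct (few_limit _ _ (cap_few x)) as [t0 H].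
  destruct (guess_potential x) as (p & P1 & P2 & P3).
  apply (few_limit (fun s => guess s x) (cap t0 x)). exists p. repeat split; auto.
  intros s. rewrite <- (H (s + t0)) by lia.
  etransitivity; [apply (mono_le p P1 s (s + t0)); lia | apply P2].
Qed.

(** * Success of the guesses against a genuine approximation *)

Section Diagonal.
  Variables (c d k : nat) (G : nat -> nat -> nat) (b r : nat -> nat).
  Hypothesis HG : forall x t, Phi emptyO c (pair x t) (G x t).
  Hypothesis Hb : forall x, Phi emptyO d x (b x).
  Hypothesis Hch : forall x, changes_le (G x) (b x).
  Hypothesis Hlim : forall x, exists t0, forall t, t0 <= t -> G x t = r x.
  Let n := pair c d.
  Let x := pair n k.

  Let count t := length (filter (fun u => negb (G n u =? G n (S u))) (seq 0 t)).

  Lemma count_le t : count t <= b n.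
  Proof.
    apply Hch.
    - apply NoDup_filter, seq_NoDup.
    - intros y [_ Hy]%filter_In. apply Bool.negb_true_iff, Nat.eqb_neq in Hy. exact Hy.
  Qed.

  Lemma count_S t : count (S t) = count t + (if G n t =? G n (S t) then 0 else 1).
  Proof.
    unfold count. rewrite seq_S, filter_app, length_app. simpl.
    now destruct (G n t =? G n (S t)).
  Qed.

  Lemma bound_val_cases s : bound_val s x = 0 \/ bound_val s x = S (b n).
  Proof.
    unfold bound_val, x. rewrite !fst_pair.
    replace (snd_of n) with d by (symmetry; apply snd_pair).
    destruct (eval0 s d n) as [|v] eqn:E; [now left | right].
    destruct (Phi_steps _ _ _ _ (Hb n)) as [t Ht].
    now rewrite (eval_steps_det _ _ _ _ _ _ _ E Ht).
  Qed.

  Lemma value_cases s t :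
    eval0 s (fst_of (fst_of x)) (pair (fst_of x) t) = 0 \/
    eval0 s (fst_of (fst_of x)) (pair (fst_of x) t) = S (G n t).
  Proof.
    unfold x. rewrite !fst_pair.
    replace (fst_of n) with c by (symmetry; apply fst_pair).
    destruct (eval0 s c (pair n t)) as [|v] eqn:E; [now left | right].
    destruct (Phi_steps _ _ _ _ (HG n t)) as [t' Ht].
    now rewrite (eval_steps_det _ _ _ _ _ _ _ E Ht).
  Qed.

  (* For a genuine approximation the cap on the number of changes is not reached. *)
  Lemma approx_genuine s :
    (ap_time s x = 0 /\ ap_val s x = 0 /\ ap_count s x = 0) \/
    exists t, ap_time s x = S t /\ ap_val s x = S (G n t) /\ ap_count s x = S (count t).
  Proof.
    induction s as [|s IH].
    - left. unfold ap_time, ap_val, ap_count, approx. cbn [prec]. now proj.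
    - unfold ap_time, ap_val, ap_count in *. rewrite approx_S. unfold approx_step.
      destruct (bound_val_cases s) as [E | E]; rewrite E; simpl Nat.eqb; cbv iota; [exact IH |].
      destruct (value_cases s (fst_of (approx s x))) as [Ev | Ev]; rewrite Ev;
        simpl Nat.eqb; cbv iota; [exact IH |].
      right. exists (fst_of (approx s x)).
      destruct IH as [(E1 & E2 & E3) | (t & E1 & E2 & E3)]; rewrite E2, E3, E1.
      (* The first value counts as a change from the initial [0]; the successor in [bound_val]
         leaves room for it. *)
      + simpl Nat.eqb. cbv iota. change (0 <? S (b n)) with true. cbv iota. now proj.
      + pose proof (count_le (S t)) as Hc. rewrite count_S in *.
        revert Hc. destruct (Nat.eqb_spec (G n t) (G n (S t))) as [Eg | Eg]; intros Hc.
        * rewrite Eg, Nat.eqb_refl. proj. rewrite E2, E3. repeat split; [congruence | lia].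
        * destruct (Nat.eqb_spec (G n (S t)) (G n t)); [congruence |].
          destruct (Nat.ltb_spec (S (count t)) (S (b n))); [| lia]. proj.
          repeat split; lia.
  Qed.

  Lemma value_found t : exists s0, forall s, s0 <= s ->
    bound_val s x = S (b n) /\
    eval0 s (fst_of (fst_of x)) (pair (fst_of x) t) = S (G n t).
  Proof.
    unfold bound_val, x. rewrite !fst_pair.
    replace (snd_of n) with d by (symmetry; apply snd_pair).
    replace (fst_of n) with c by (symmetry; apply fst_pair).
    destruct (Phi_steps _ _ _ _ (Hb n)) as [s1 H1].
    destruct (Phi_steps _ _ _ _ (HG n t)) as [s2 H2].
    exists (s1 + s2). intros s Hs.
    split; [apply (eval_steps_mono _ s1) | apply (eval_steps_mono _ s2)]; auto; lia.
  Qed.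

  Lemma ap_time_unbounded m : exists s, m <= ap_time s x.
  Proof.
    induction m as [|m [s Hs]]; [exists 0; lia |].
    destruct (Nat.eq_dec m (ap_time s x)) as [E |]; [| exists s; lia].
    destruct (value_found m) as [s0 H].
    destruct (H (s + s0) ltac:(lia)) as [H1 H2].
    pose proof (mono_le (fun s => ap_time s x) (fun s => ap_time_mono s x) s (s + s0)
      ltac:(lia)) as Hle. cbv beta in Hle.
    destruct (Nat.eq_dec m (ap_time (s + s0) x)) as [E' |]; [| exists (s + s0); lia].
    exists (S (s + s0)). unfold ap_time in *. rewrite approx_S. unfold approx_step.
    rewrite H1, <- E', H2. change (S (b n) =? 0) with false.
    change (S (G n m) =? 0) with false. cbv iota.
    destruct (S (G n m) =? _); [proj; lia |]. destruct (_ <? S (b n)); proj; lia.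
  Qed.

  Lemma ap_val_limit : exists s0, forall s, s0 <= s -> ap_val s x = S (r n).
  Proof.
    destruct (Hlim n) as [t0 Ht]. destruct (ap_time_unbounded (S t0)) as [s0 H0].
    exists s0. intros s Hs.
    pose proof (mono_le (fun s => ap_time s x) (fun s => ap_time_mono s x) s0 s Hs) as Hle.
    cbv beta in Hle. destruct (approx_genuine s) as [(E & _) | (t & E & -> & _)]; [lia |].
    now rewrite Ht by lia.
  Qed.

  (** A limit guess below [k] is still not enumerated at late stages, so it is outside the set. A
      limit guess [k] means that all smaller numbers have been enumerated, and with [k] itself the
      set would have [k + 1] elements. *)
  Lemma guess_avoids z : card_le (W (r n)) k ->
    (exists t0, forall t, t0 <= t -> guess t x = z) -> ~ W (r n) z.
  Proof.
    intros Hcard [t0 Hz] [v Hv].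
    destruct ap_val_limit as [s0 Hs0].
    destruct (Phi_steps _ _ _ _ Hv) as [s1 Hs1].
    set (s := t0 + s0 + s1).
    apply (eval_steps_mono _ s1 s) in Hs1; [| lia].
    pose proof (Hz s ltac:(lia)) as Eg. unfold guess in Eg.
    rewrite (Hs0 s) in Eg by lia. simpl Nat.eqb in Eg. cbv iota in Eg.
    unfold x in Eg. rewrite snd_pair in Eg. fold x in Eg.
    set (P := fun j => eval0 s (r n) j =? 0) in Eg.
    assert (Hk : z = k).
    { pose proof (bmin_le P k). destruct (Nat.eq_dec z k); [assumption |].
      pose proof (bmin_found P k ltac:(lia)) as H1. rewrite Eg in H1.
      unfold P, eval0 in H1. rewrite Hs1 in H1. discriminate. }
    rewrite Hk in Hv, Eg. pose proof (Hcard (seq 0 (S k)) (seq_NoDup _ _)) as H.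
    rewrite length_seq in H. enough (S k <= k) by lia. apply H.
    intros y Hy%in_seq. destruct (Nat.eq_dec y k) as [-> |]; [exists v; exact Hv |].
    pose proof (bmin_before P k y ltac:(lia)) as Hb'. unfold P in Hb'.
    destruct (eval0 s (r n) y) as [|w] eqn:E; [discriminate |].
    exists w. eapply eval_steps_sound; [| exact E]. unfold full. congruence.
  Qed.
End Diagonal.

(** * Strings and forcing the jump *)

(* [w = pair l v] codes the string of length [l] given by the binary digits of [v]. *)
Definition len w := fst_of w.
Definition bitb w z := (snd_of w / 2 ^ z) mod 2 =? 1.
(** Queries beyond the length block the machine, so a computation that halts on [w] is valid for
    every set with initial segment [w]. *)
Definition qs w z := if z <? len w then S (bit01 (bitb w z)) else 0.
Definition emp := pair 0 0.

(* [w] followed by [0 ^ n 1] *)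
Definition app w n := pair (S (len w + n)) (snd_of w mod 2 ^ len w + 2 ^ (len w + n)).

Definition ext w w' := len w <= len w' /\ forall z, z < len w -> bitb w' z = bitb w z.

Definition extb w w' :=
  andb (len w <=? len w')
    (len w <=? bmin (fun z => negb (bit01 (bitb w' z) =? bit01 (bitb w z))) (len w)).

Definition below (A : nat -> bool) w := forall z, z < len w -> A z = bitb w z.

Lemma ext_refl w : ext w w.
Proof. split; auto. Qed.

Lemma ext_trans u v w : ext u v -> ext v w -> ext u w.
Proof.
  intros [H1 H2] [H3 H4]. split; [lia |]. intros z Hz. rewrite H4 by lia. auto.
Qed.

Lemma ext_below A w w' : ext w w' -> below A w' -> below A w.
Proof. intros [H1 H2] H z Hz. rewrite H by lia. auto. Qed.

Lemma bit01_inj a b : bit01 a = bit01 b -> a = b.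
Proof. now destruct a, b. Qed.

Lemma extb_spec w w' : extb w w' = true <-> ext w w'.
Proof.
  unfold extb, ext. rewrite Bool.andb_true_iff, !Nat.leb_le.
  set (P := fun z => negb (bit01 (bitb w' z) =? bit01 (bitb w z))).
  split; intros [H1 H2]; (split; [assumption |]).
  - intros z Hz. pose proof (bmin_before P (len w) z ltac:(lia)) as H.
    apply Bool.negb_false_iff, Nat.eqb_eq in H. now apply bit01_inj.
  - destruct (Nat.le_gt_cases (len w) (bmin P (len w))) as [| H]; [assumption |].
    pose proof (bmin_found P _ H) as Hf.
    apply Bool.negb_true_iff, Nat.eqb_neq in Hf. rewrite H2 in Hf; easy.
Qed.

Lemma len_app w n : len (app w n) = S (len w + n).
Proof. unfold len, app. now proj. Qed.

Lemma div_pow_add a d z : (a + 2 ^ (z + S d)) / 2 ^ z mod 2 = a / 2 ^ z mod 2.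
Proof.
  replace (2 ^ (z + S d)) with (2 ^ d * 2 * 2 ^ z)
    by (rewrite Nat.pow_add_r, Nat.pow_succ_r'; lia).
  rewrite Nat.div_add by (apply Nat.pow_nonzero; lia). apply Nat.Div0.mod_add.
Qed.

Lemma bit_mod v l z : z < l -> (v mod 2 ^ l) / 2 ^ z mod 2 = v / 2 ^ z mod 2.
Proof.
  intros H. rewrite (Nat.div_mod_eq v (2 ^ l)) at 2.
  replace (2 ^ l * (v / 2 ^ l)) with (2 ^ (l - S z) * (v / 2 ^ l) * 2 * 2 ^ z).
  - rewrite Nat.add_comm, Nat.div_add by (apply Nat.pow_nonzero; lia).
    now rewrite Nat.Div0.mod_add.
  - replace l with (l - S z + S z) at 3 by lia. rewrite Nat.pow_add_r, Nat.pow_succ_r'. lia.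
Qed.

Lemma app_ext w n : ext w (app w n).
Proof.
  split; [rewrite len_app; lia |]. intros z Hz. unfold bitb, app. proj.
  replace (len w + n) with (z + S (len w + n - S z)) by lia.
  now rewrite div_pow_add, bit_mod.
Qed.

Lemma app_bit_pad w n z : len w <= z < len w + n -> bitb (app w n) z = false.
Proof.
  intros Hz. unfold bitb, app. proj.
  replace (len w + n) with (z + S (len w + n - S z)) by lia.
  rewrite div_pow_add, Nat.div_small; [reflexivity |].
  apply Nat.lt_le_trans with (2 ^ len w); [apply Nat.mod_upper_bound, Nat.pow_nonzero; lia |].
  apply Nat.pow_le_mono_r; lia.
Qed.

Lemma app_bit_last w n : bitb (app w n) (len w + n) = true.
Proof.
  unfold bitb, app. proj.
  rewrite <- (Nat.mul_1_l (2 ^ (len w + n))) at 1.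
  rewrite Nat.div_add, Nat.div_small; [reflexivity | | apply Nat.pow_nonzero; lia].
  apply Nat.lt_le_trans with (2 ^ len w); [apply Nat.mod_upper_bound, Nat.pow_nonzero; lia |].
  apply Nat.pow_le_mono_r; lia.
Qed.

Lemma qs_below A w : below A w -> forall z b, qs w z = S b -> b = bit01 (A z).
Proof.
  intros H z b. unfold qs. destruct (Nat.ltb_spec z (len w)); [| discriminate].
  rewrite H by assumption. congruence.
Qed.

Lemma qs_full A w z : below A w -> z < len w -> qs w z = full A z.
Proof.
  intros H Hz. unfold qs, full. apply Nat.ltb_lt in Hz as Hb. now rewrite Hb, H.
Qed.

(* [u = pair w' s]: the extension [w'] of [w] makes the jump at [x] halt within [s] steps *)
Definition forces x w u :=
  andb (extb w (fst_of u))
    (0 <? eval_steps (qs (fst_of u)) (snd_of u) x x).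

Definition found s x w := bmin (forces x w) s <? s.

Definition force s x w := if found s x w then fst_of (bmin (forces x w) s) else w.

Lemma force_ext s x w : ext w (force s x w).
Proof.
  unfold force, found. destruct (Nat.ltb_spec (bmin (forces x w) s) s) as [H |];
    [| apply ext_refl].
  apply bmin_found in H. apply Bool.andb_true_iff in H. now apply extb_spec.
Qed.

Lemma found_intro s x w u : u < s -> forces x w u = true -> found s x w = true.
Proof.
  intros Hu Hf. apply Nat.ltb_lt. pose proof (bmin_least _ s _ Hf). lia.
Qed.

Lemma force_halts s x w : found s x w = true ->
  exists t v, eval_steps (qs (force s x w)) t x x = S v.
Proof.
  intros H. unfold force. rewrite H. apply Nat.ltb_lt, bmin_found in H.
  apply Bool.andb_true_iff in H as [_ H]. apply Nat.ltb_lt in H.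
  destruct (eval_steps _ _ x x) as [|v] eqn:E in H; [lia |].
  eexists _, v. exact E.
Qed.

(** The least witness below [s] remains the least one below [S s], so for fixed [w] the outcome is
    final once the search has succeeded. *)
Lemma found_S s x w : found s x w = true ->
  found (S s) x w = true /\ force (S s) x w = force s x w.
Proof.
  intros H. apply Nat.ltb_lt in H as Hlt.
  assert (E : bmin (forces x w) (S s) = bmin (forces x w) s).
  { apply bmin_eq; [lia | intros; eapply bmin_before; eassumption |].
    intros _. now apply bmin_found. }
  unfold force. assert (H' : found (S s) x w = true).
  { unfold found. rewrite E. apply Nat.ltb_lt. lia. }
  now rewrite H, H', E.
Qed.

(** * The strings along a path of branches *)

Section Path.
  (* [ch] chooses the branch taken at a level, given the string reached there *)
  Variables (s : nat) (ch : nat -> nat -> nat).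

  Fixpoint rho n : nat :=
    force s n (match n with 0 => emp | S i => app (rho i) (cap s i + ch i (rho i)) end).

  Definition base n :=
    match n with 0 => emp | S i => app (rho i) (cap s i + ch i (rho i)) end.

  Lemma rho_eq n : rho n = force s n (base n).
  Proof. now destruct n. Qed.

  Lemma rho_S_ext i : ext (app (rho i) (cap s i + ch i (rho i))) (rho (S i)).
  Proof. rewrite (rho_eq (S i)). apply force_ext. Qed.

  Lemma rho_mono i j : i <= j -> ext (rho i) (rho j).
  Proof.
    intros H. induction H as [|j H IH]; [apply ext_refl |].
    eapply ext_trans; [exact IH |].
    eapply ext_trans; [apply app_ext | apply rho_S_ext].
  Qed.

  Lemma rho_lt_ext i j : i < j -> ext (app (rho i) (cap s i + ch i (rho i))) (rho j).
  Proof. intros H. eapply ext_trans; [apply rho_S_ext | now apply rho_mono]. Qed.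

  Lemma rho_len n : n <= len (rho n).
  Proof.
    induction n as [|n IH]; [lia |]. destruct (rho_S_ext n) as [H _].
    rewrite len_app in H. lia.
  Qed.
End Path.

Lemma rho_congr s ch ch' n : (forall i w, i < n -> ch i w = ch' i w) ->
  rho s ch n = rho s ch' n.
Proof.
  intros H. induction n as [|n IH]; [reflexivity |].
  rewrite !rho_eq. simpl base. rewrite IH by auto. now rewrite H by lia.
Qed.

(** The starting point of the search at level [S i] changes through the string at level [i] or,
    once, through the cap. Between such events the search succeeds at most once, which turns [k]
    changes into [k * 2 + 1]. *)
Fixpoint rho_bound n := match n with 0 => 1 | S i => S (rho_bound i) * 2 + 1 end.

Lemma rho_bound_mono i j : i <= j -> rho_bound i <= rho_bound j.
Proof. apply mono_le. simpl. lia. Qed.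

(** Branches may depend on the stage only through the cap. This admits fixed branches and branches
    read off from an oracle behind the padding, but not the guesses themselves. *)
Lemma rho_few (c : nat -> nat -> nat -> nat) :
  (forall s i w, cap s i = cap (S s) i -> c s i w = c (S s) i w) ->
  forall n, few (fun s => rho s (c s) n <> rho (S s) (c (S s)) n) (rho_bound n).
Proof.
  intros Hc.
  assert (Hf : forall n C k, few C k ->
    (forall s, C s \/ base s (c s) n = base (S s) (c (S s)) n) ->
    few (fun s => rho s (c s) n <> rho (S s) (c (S s)) n) (k * 2 + 1)).
  { intros n C k HC Hb.
    eapply few_impl with (D := fun s => C s \/ rho s (c s) n <> rho (S s) (c (S s)) n);
      [now right | apply le_n |].
    apply (few_reset _ _ _ (fun s => bit01 (found s n (base s (c s) n)))); [assumption |..].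
    - intros s. destruct (found _ _ _); simpl; lia.
    - intros s. destruct (Hb s) as [| <-]; [now left | right].
      destruct (found s n _) eqn:E; [| simpl; lia].
      apply found_S in E as [-> _]. reflexivity.
    - intros s Hne. destruct (Hb s) as [| Eb]; [now left | right].
      rewrite !rho_eq, <- Eb in Hne. rewrite <- Eb.
      destruct (found s n _) eqn:E.
      + apply found_S in E as [_ E]. congruence.
      + destruct (found (S s) n _) eqn:E'; [simpl; lia |].
        unfold force in Hne. now rewrite E, E' in Hne. }
  induction n as [|n IH].
  - apply (Hf 0 (fun _ => False) 0); [| now right].
    exists (fun _ => 0). repeat split; auto. easy.
  - change (rho_bound (S n)) with (S (rho_bound n) * 2 + 1).
    rewrite <- (Nat.add_1_r (rho_bound n)).
    apply (Hf (S n) _ _ (few_or _ _ _ _ IH (cap_few n))). intros s. simpl base.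
    destruct (Nat.eq_dec (rho s (c s) n) (rho (S s) (c (S s)) n)) as [<- |]; [| tauto].
    destruct (Nat.eq_dec (cap s n) (cap (S s) n)) as [Ec |]; [right | tauto].
    now rewrite <- Hc, Ec.
Qed.

(* Digits in the factorial number system: the [q < fact n] represent exactly the
   choices of branches at the levels below [n]. *)
Definition dig q (i w : nat) := q / fact i mod S i.

(** Adding [z n * fact n] sets digit [n] and leaves the lower digits alone, because [fact n] is a
    multiple of [S i * fact i] for [i < n]. *)
Lemma digits (z : nat -> nat) n : (forall i, z i <= i) ->
  exists q, q < fact n /\ forall i, i < n -> q / fact i mod S i = z i.
Proof.
  intros Hz. induction n as [|n (q & Hq & IH)]; [exists 0; split; [simpl; lia | lia] |].
  exists (q + z n * fact n). split.
  - specialize (Hz n). change (fact (S n)) with (S n * fact n). nia.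
  - intros i Hi. destruct (Nat.eq_dec i n) as [-> |].
    + rewrite Nat.div_add by apply fact_neq_0. rewrite Nat.div_small by assumption.
      apply Nat.mod_small. specialize (Hz n). lia.
    + assert (Hd : exists m, fact n = m * S i * fact i).
      { assert (Hin : S i <= n) by lia. clear -Hin. induction Hin as [|k Hin [m IH]].
        - exists 1. simpl. lia.
        - exists (S k * m). change (fact (S k)) with (S k * fact k). rewrite IH. lia. }
      destruct Hd as [m Hm]. rewrite <- (IH i) by lia. rewrite Hm, !Nat.mul_assoc.
      rewrite Nat.div_add by apply fact_neq_0. apply Nat.Div0.mod_add.
Qed.

Lemma guess_digits s n : exists q, q < fact n /\
  forall i w, i < n -> dig q i w = guess s i.
Proof.
  destruct (digits (guess s) n) as (q & Hq & H).
  - intros i. pose proof (guess_le s i). pose proof (snd_le i). lia.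
  - exists q. split; auto. intros i w Hi. now apply H.
Qed.

(** * The set and its approximation *)

Definition path s (i w : nat) := guess s i.
Definition approxA s m := bitb (rho s (path s) (S m)) m.

(** The summands count changes of strings up to level [S m] for all fixed choices of branches,
    changes of caps at levels up to [m], and changes of those guesses whose cap is at most [m]. *)
Definition A_bound m := S (S m) * (fact (S m) * rho_bound (S m)) + (S m * 1 + S m * m).

(* Where padding beyond [m] precedes the coded guess, changes of that guess do
   not affect bit [m]; at the other levels the guess changes at most [m] times. *)
Lemma approxA_few m : few (fun s => approxA s m <> approxA (S s) m) (A_bound m).
Proof.
  unfold A_bound.
  eapply few_impl; [| apply le_n |]; cycle 1.
  - apply few_or; [| apply few_or].
    + apply (few_bex (fun i s => exists q, q < fact (S m) /\
        rho s (dig q) i <> rho (S s) (dig q) i)).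
      intros i Hi. apply few_bex. intros q _.
      eapply few_impl; [intros s Hs; exact Hs | apply (rho_bound_mono i); lia |].
      now apply (rho_few (fun _ => dig q)).
    + apply (few_bex (fun i s => cap s i <> cap (S s) i)). intros i _. apply cap_few.
    + apply (few_bex (fun i s => cap s i = cap (S s) i /\ cap s i <= m /\
        guess s i <> guess (S s) i)).
      intros i _. destruct (guess_potential i) as (p & P1 & P2 & P3).
      (* At the events counted here the potential is bounded by a cap of at most [m], so truncation
         at [m] loses none of them. *)
      exists (fun s => Nat.min (p s) m). repeat split; intros s.
      * specialize (P1 s). lia.
      * lia.
      * intros (E & Hm & Hne). apply P3 in Hne. specialize (P2 (S s)). lia.
  - intros s Hne. apply NNPP. intros Hn. apply Hne. clear Hne.
    assert (Hr : forall i q, i < S (S m) -> q < fact (S m) ->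
      rho s (dig q) i = rho (S s) (dig q) i).
    { intros i q Hi Hq. apply NNPP. intros H. apply Hn. left. eauto. }
    assert (Hc : forall i, i < S m -> cap s i = cap (S s) i).
    { intros i Hi. apply NNPP. intros H. apply Hn. right; left. eauto. }
    assert (Hg : forall i, i < S m -> guess s i <> guess (S s) i -> m < cap s i).
    { intros i Hi H. apply Nat.nle_gt. intros H'. apply Hn. right; right. eauto 6. }
    destruct (guess_digits s (S m)) as (q & Hq & Hd).
    assert (Hs : forall i, i < S (S m) -> rho s (path s) i = rho s (dig q) i).
    { intros i Hi. apply rho_congr. intros j w Hj. symmetry. apply Hd. lia. }
    (* Take the least level where the guess changes, if any: both stages follow the same branches to
       it, hence reach the same string there. *)
    assert (Hl : forall n, n <= S m ->
      (forall i, i < n -> guess s i = guess (S s) i) \/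
      exists i, i < n /\ guess s i <> guess (S s) i /\
        forall j, j < i -> guess s j = guess (S s) j).
    { induction n as [|n IH]; intros H; [left; lia |].
      destruct IH as [IH | (i & H1 & H2 & H3)]; [lia | | right; exists i; auto].
      destruct (Nat.eq_dec (guess s n) (guess (S s) n)) as [E |].
      - left. intros i Hi. destruct (Nat.eq_dec i n) as [-> |]; [exact E | apply IH; lia].
      - right. exists n. auto. }
    assert (HS : forall i, i < S (S m) -> (forall j, j < i -> guess s j = guess (S s) j) ->
      rho (S s) (path (S s)) i = rho s (path s) i).
    { intros i Hi Hj. rewrite Hs, Hr by assumption. apply rho_congr.
      intros j w Hji. unfold path. rewrite <- Hj by assumption. symmetry. apply Hd. lia. }
    unfold approxA.
    destruct (Hl (S m) (le_n _)) as [H | (i & Hi & Hne & Hj)]; [now rewrite HS by auto |].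
    pose proof (Hg i Hi Hne) as Hm.
    pose proof (rho_lt_ext s (path s) i (S m) Hi) as [L1 E1].
    pose proof (rho_lt_ext (S s) (path (S s)) i (S m) Hi) as [L2 E2].
    rewrite HS in L2, E2 by (auto; lia). rewrite <- Hc in L2, E2 by assumption.
    rewrite len_app in E1, E2. rewrite E1, E2 by lia.
    (* Bit [m] lies either in this common string or in the zeros behind it, whose number exceeds
       [m]. *)
    destruct (Nat.lt_ge_cases m (len (rho s (path s) i))) as [Hlt | Hge].
    + destruct (app_ext (rho s (path s) i) (cap s i + path s i (rho s (path s) i))) as [_ ->];
        [| assumption].
      destruct (app_ext (rho s (path s) i)
        (cap s i + path (S s) i (rho s (path s) i))) as [_ ->]; auto.
    + now rewrite !app_bit_pad by lia.
Qed.

Lemma limit_fun {X} (g : nat -> nat -> X) :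
  (forall m, exists t0, forall t, t0 <= t -> g t m = g t0 m) ->
  exists f, forall m, exists t0, forall t, t0 <= t -> g t m = f m.
Proof.
  intros H.
  exists (fun m => g (proj1_sig (constructive_indefinite_description _ (H m))) m).
  intros m. destruct (constructive_indefinite_description _ (H m)) as [t0 Ht0]. simpl.
  now exists t0.
Qed.

Lemma levels_settle n : exists t0, forall t i, t0 <= t -> i < n ->
  cap t i = cap t0 i /\ guess t i = guess t0 i.
Proof.
  induction n as [|n [t0 IH]]; [exists 0; lia |].
  destruct (few_limit _ _ (cap_few n)) as [t1 H1].
  destruct (guess_limit n) as [t2 H2].
  exists (t0 + t1 + t2). intros t i Ht Hi. destruct (Nat.eq_dec i n) as [-> |].
  - now rewrite (H1 t), (H1 (t0 + t1 + t2)), (H2 t), (H2 (t0 + t1 + t2)) by lia.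
  - destruct (IH t i) as [E1 E2]; [lia | lia |].
    destruct (IH (t0 + t1 + t2) i) as [E3 E4]; [lia | lia |].
    now rewrite E1, E2, E3, E4.
Qed.

(** After the guesses below level [n] have settled, the path is one with fixed branches, to which
    [rho_few] applies. *)
Lemma path_settle n :
  exists t0, forall t, t0 <= t -> rho t (path t) n = rho t0 (path t0) n.
Proof.
  destruct (levels_settle n) as [t0 H0].
  destruct (few_limit _ _ (rho_few (fun _ => path t0) (fun _ _ _ _ => eq_refl) n))
    as [t1 H1].
  assert (E : forall t, t0 <= t -> rho t (path t) n = rho t (path t0) n).
  { intros t Ht. apply rho_congr. intros i w Hi. now apply H0. }
  exists (t0 + t1). intros t Ht.
  rewrite !E by lia. now rewrite (H1 t), (H1 (t0 + t1)) by lia.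
Qed.

(** * Computability of the construction *)

Lemma cpt_eval0 O s e y : cpt O s -> cpt O e -> cpt O y ->
  cpt O (fun x => eval0 (s x) (e x) (y x)).
Proof.
  intros Hs He Hy. apply (cpt_eval_steps O (fun _ => full emptyO)); auto.
  apply (cpt_const O 1).
Qed.

Ltac cpt_hyp :=
  match goal with
  | H : cpt _ ?f |- cpt _ (fun x => ?f _) => simple apply (cpt_comp _ f)
  end.

Ltac cpt_extra ::=
  first [ simple apply cpt_div | simple apply cpt_mod | simple apply cpt_pow
        | simple apply cpt_fact | simple apply cpt_eval0 | cpt_hyp ].

Lemma cpt_bound_val O s x : cpt O s -> cpt O x -> cpt O (fun y => bound_val (s y) (x y)).
Proof. intros. unfold bound_val. cpt. Qed.

Lemma cpt_cap O s x : cpt O s -> cpt O x -> cpt O (fun y => cap (s y) (x y)).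
Proof.
  intros. unfold cap. repeat simple apply cpt_mul; cpt. now apply cpt_bound_val.
Qed.

Lemma cpt_approx O s x : cpt O s -> cpt O x -> cpt O (fun y => approx (s y) (x y)).
Proof.
  intros. unfold approx. apply cpt_prec; cpt. unfold approx_step.
  assert (cpt O (fun p => bound_val (fst_of (snd_of p)) (x (fst_of p))))
    by (apply cpt_bound_val; cpt).
  cpt.
Qed.

Lemma cpt_guess O s x : cpt O s -> cpt O x -> cpt O (fun y => guess (s y) (x y)).
Proof.
  intros. unfold guess, ap_val.
  assert (cpt O (fun y => approx (s y) (x y))) by now apply cpt_approx.
  assert (cpt O (fun p => approx (s (fst_of p)) (x (fst_of p))))
    by (apply cpt_approx; cpt).
  cpt.
Qed.

Lemma cpt_bitb O w z : cpt O w -> cpt O z -> cptb O (fun x => bitb (w x) (z x)).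
Proof. intros. unfold bitb. cpt. Qed.

Lemma cpt_qs O w z : cpt O w -> cpt O z -> cpt O (fun x => qs (w x) (z x)).
Proof.
  intros. unfold qs, len. assert (cptb O (fun x => bitb (w x) (z x))) by now apply cpt_bitb.
  cpt.
Qed.

Lemma cpt_eval_qs O w s e y : cpt O w -> cpt O s -> cpt O e -> cpt O y ->
  cpt O (fun x => eval_steps (qs (w x)) (s x) (e x) (y x)).
Proof.
  intros. apply (cpt_eval_steps O (fun x => qs (w x))); auto. apply cpt_qs; cpt.
Qed.

Lemma cpt_forces O x w u : cpt O x -> cpt O w -> cpt O u ->
  cptb O (fun y => forces (x y) (w y) (u y)).
Proof.
  intros. unfold forces, extb, len.
  assert (cpt O (fun y => eval_steps (qs (fst_of (u y))) (snd_of (u y)) (x y) (x y)))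
    by (apply cpt_eval_qs; cpt).
  repeat first
    [ simple apply cpt_andb | simple apply cpt_leb | simple apply cpt_ltb
    | simple apply cpt_bmin | simple apply cpt_negb | simple apply cpt_eqb ]; cpt;
    apply cpt_bitb; cpt.
Qed.

Lemma cpt_force O s x w : cpt O s -> cpt O x -> cpt O w ->
  cpt O (fun y => force (s y) (x y) (w y)).
Proof.
  intros. unfold force, found.
  assert (cptb O (fun p => forces (x (fst_of p)) (w (fst_of p)) (snd_of p)))
    by (apply cpt_forces; cpt).
  cpt.
Qed.

Lemma rho_prec s ch n :
  rho s ch n =
  prec (force s 0 emp) (fun i w => force s (S i) (app w (cap s i + ch i w))) n.
Proof. induction n as [|n IH]; [reflexivity |]. simpl. now rewrite IH. Qed.

Lemma cpt_rho O (s n : nat -> nat) (ch : nat -> nat -> nat -> nat) :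
  cpt O s -> cpt O n ->
  cpt O (fun p => ch (fst_of p) (fst_of (snd_of p)) (snd_of (snd_of p))) ->
  cpt O (fun x => rho (s x) (ch x) (n x)).
Proof.
  intros. eapply cpt_ext; [intros x; symmetry; apply rho_prec |].
  unfold emp, app, len. apply cpt_prec; auto.
  - apply cpt_force; cpt.
  - assert (cpt O (fun p => cap (s (fst_of p)) (fst_of (snd_of p))))
      by (apply cpt_cap; cpt).
    apply cpt_force; cpt.
Qed.

Lemma cpt_rho_bound O f : cpt O f -> cpt O (fun x => rho_bound (f x)).
Proof.
  intros. apply (cpt_ext O (fun x => prec 1 (fun _ y => S y * 2 + 1) (f x))); [| cpt].
  intros x. induction (f x) as [|n IH]; [reflexivity |]. cbn [prec]. now rewrite IH.
Qed.

Lemma cpt_approxA O s m : cpt O s -> cpt O m ->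
  cptb O (fun x => approxA (s x) (m x)).
Proof.
  intros. unfold approxA. apply cpt_bitb; [| assumption].
  apply (cpt_rho O s (fun x => S (m x)) (fun x => path (s x))); cpt.
  unfold path. apply cpt_guess; cpt.
Qed.

Lemma code_of_cpt2 O (G : nat -> nat -> nat) :
  cpt O (fun p => G (fst_of p) (snd_of p)) ->
  exists c, forall x t, Phi O c (pair x t) (G x t).
Proof.
  intros [c Hc]. destruct (decode_surj c) as [e <-]. exists e. intros x t.
  specialize (Hc (pair x t)). now rewrite fst_pair, snd_pair in Hc.
Qed.

Lemma unif_ce_ex (R : nat -> nat -> Prop) (test : nat -> nat -> bool) :
  cptb emptyO (fun p => test (fst_of p) (snd_of p)) ->
  (forall x y, R x y <-> exists u, test (pair x y) u = true) -> unif_ce R.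
Proof.
  intros Ht HR. destruct (cpt_negb emptyO _ Ht) as [c Hc].
  destruct (decode_surj (CMu c)) as [e He]. exists e. intros x y. rewrite HR.
  unfold W, Phi. rewrite He.
  assert (Hcu : forall u, evalR emptyO c (pair (pair x y) u)
                            (bit01 (negb (test (pair x y) u)))).
  { intros u. specialize (Hc (pair (pair x y) u)). now rewrite fst_pair, snd_pair in Hc. }
  split.
  - intros [u Hu]. exists (bmin (test (pair x y)) u).
    assert (Hb : test (pair x y) (bmin (test (pair x y)) u) = true).
    { destruct (Nat.eq_dec (bmin (test (pair x y)) u) u) as [-> |]; [assumption |].
      apply bmin_found. pose proof (bmin_le (test (pair x y)) u). lia. }
    apply eMu.
    + specialize (Hcu (bmin (test (pair x y)) u)). now rewrite Hb in Hcu.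
    + intros m Hm%bmin_before. exists 1. split; [easy |].
      specialize (Hcu m). now rewrite Hm in Hcu.
  - intros [u Hu]. exists u. inversion Hu as [| | | | | | | | | | f' x' n' H0 _]; subst.
    pose proof (Hcu u) as H1.
    destruct (test (pair x y) u); [reflexivity |]. exfalso.
    destruct (decode_surj c) as [e' <-].
    pose proof (Phi_fun _ _ _ _ _ H0 H1). discriminate.
Qed.

(** * Properties of the limit set *)

Section Limit.
  Variables (A : nat -> bool) (rl zl : nat -> nat).
  Hypothesis HA : forall m, exists t0, forall t, t0 <= t -> approxA t m = A m.
  Hypothesis Hrl : forall n, exists t0, forall t, t0 <= t -> rho t (path t) n = rl n.
  Hypothesis Hzl : forall n, exists t0, forall t, t0 <= t -> guess t n = zl n.

  Lemma rl_below n : below A (rl n).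
  Proof.
    intros z Hz. destruct (HA z) as [t1 H1]. destruct (Hrl n) as [t2 H2].
    rewrite <- (H1 (t1 + t2)), <- (H2 (t1 + t2)) in * by lia.
    unfold approxA. set (t := t1 + t2) in *.
    pose proof (rho_len t (path t) (S z)) as Hl.
    destruct (Nat.le_ge_cases n (S z)) as [Hle | Hle].
    - destruct (rho_mono t (path t) n (S z) Hle) as [_ E]. now apply E.
    - destruct (rho_mono t (path t) (S z) n Hle) as [_ E]. symmetry. apply E. lia.
  Qed.

  Lemma rl_len n : n <= len (rl n).
  Proof. destruct (Hrl n) as [t H]. rewrite <- (H t) by lia. apply rho_len. Qed.

  Lemma A_omega_ce : omega_ce_set A.
  Proof.
    destruct (code_of_cpt2 emptyO (fun x t => bit01 (approxA t x))) as [c Hc].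
    { apply cpt_approxA; cpt. }
    exists c, (fun x t => bit01 (approxA t x)), A_bound. repeat split.
    - exact Hc.
    - apply cpt_computable. unfold A_bound.
      assert (cpt emptyO (fun x => rho_bound (S x))) by (apply cpt_rho_bound; cpt).
      cpt.
    - intros x. apply few_card. eapply few_impl; [| apply le_n | apply approxA_few].
      cbv beta. intros s H E. apply H. now rewrite E.
    - intros x. destruct (HA x) as [t0 H]. exists t0. intros t Ht. now rewrite H.
  Qed.

  (** Ranging over all choices of branches and all stages makes the trace c.e. without knowledge of
      the true path. *)
  Definition traced x y := exists q s, q < fact x /\
    exists t, eval_steps (qs (rho s (dig q) x)) t x x = S y.

  (** Each of the [x!] choices produces at most [rho_bound x + 1] strings, each with at most one
      value of the jump; the summand [x] makes unboundedness immediate. *)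
  Definition trace_bound x := fact x * S (rho_bound x) + x.

  (* At a late stage the jump is already decided by the string at level [x]. *)
  Lemma jump_traced x y : J A x y -> traced x y.
  Proof.
    intros HJ. destruct (Phi_use _ _ _ _ HJ) as [u Hu].
    (* Level [x + u] is high enough both to cover the use [u] and to extend the string at level
       [x]. *)
    destruct (Hu (qs (rl (x + u)))) as [t Ht].
    { intros z Hz. apply qs_full; [apply rl_below |].
      pose proof (rl_len (x + u)). lia. }
    destruct (Hrl x) as [s1 H1]. destruct (Hrl (x + u)) as [s2 H2].
    (* The stage exceeds the code of the witness, so the search at level [x] has come across it. *)
    set (s := S (s1 + s2 + pair (rl (x + u)) t)).
    assert (Hf : found s x (base s (path s) x) = true).
    { apply (found_intro _ _ _ (pair (rl (x + u)) t)); [unfold s; lia |].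
      unfold forces. proj. rewrite Ht. apply Bool.andb_true_iff. split; [| reflexivity].
      apply extb_spec. rewrite <- (H2 s) by (unfold s; lia).
      eapply ext_trans; [| apply (rho_mono s (path s) x); lia].
      rewrite rho_eq. apply force_ext. }
    apply force_halts in Hf as (t' & v & Hv). rewrite <- rho_eq in Hv.
    (* The search may have chosen another extension, but its string is an initial part of [A], so
       the value is that of the jump of [A]. *)
    assert (v = y) as ->.
    { apply (Phi_fun A x x); [| assumption]. eapply eval_steps_sound; [| exact Hv].
      intros z b. apply qs_below. rewrite H1 by (unfold s; lia). apply rl_below. }
    destruct (guess_digits s x) as (q & Hq & Hd). exists q, s. split; [assumption |].
    exists t'. rewrite (rho_congr s (dig q) (path s)); [exact Hv |].
    intros i w Hi. now apply Hd.
  Qed.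

  Lemma A_jump_traceable : jump_traceable A.
  Proof.
    exists trace_bound, traced. repeat split.
    - apply cpt_computable. unfold trace_bound.
      assert (cpt emptyO (fun x => rho_bound x)) by (apply cpt_rho_bound; cpt). cpt.
    - intros x y Hxy. unfold trace_bound. pose proof (fact_le x y Hxy).
      pose proof (rho_bound_mono x y Hxy). nia.
    - intros m. exists m. unfold trace_bound. lia.
    - apply (unif_ce_ex _ (fun p u => andb (fst_of u <? fact (fst_of p))
        (eval_steps (qs (rho (fst_of (snd_of u)) (dig (fst_of u)) (fst_of p)))
           (snd_of (snd_of u)) (fst_of p) (fst_of p) =? S (snd_of p)))).
      + assert (cpt emptyO (fun p => rho (fst_of (snd_of (snd_of p)))
                  (dig (fst_of (snd_of p))) (fst_of (fst_of p)))).
        { apply (cpt_rho _ (fun p => fst_of (snd_of (snd_of p))) (fun p => fst_of (fst_of p))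
            (fun p => dig (fst_of (snd_of p)))); cpt. unfold dig. cpt. }
        assert (cpt emptyO (fun p => eval_steps (qs (rho (fst_of (snd_of (snd_of p)))
                  (dig (fst_of (snd_of p))) (fst_of (fst_of p))))
           (snd_of (snd_of (snd_of p))) (fst_of (fst_of p)) (fst_of (fst_of p))))
          by (apply cpt_eval_qs; cpt).
        cpt.
      + intros x y. split.
        * intros (q & s & Hq & t & Ht). exists (pair q (pair s t)). proj.
          rewrite Ht. apply Bool.andb_true_iff. split; [now apply Nat.ltb_lt |].
          apply Nat.eqb_refl.
        * intros (u & [H1 H2]%Bool.andb_true_iff). rewrite !fst_pair, snd_pair in *.
          apply Nat.ltb_lt in H1. apply Nat.eqb_eq in H2.
          exists (fst_of u), (fst_of (snd_of u)). eauto.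
    - intros x l Hnd Hl. unfold trace_bound.
      enough (length l <= fact x * S (rho_bound x)) by lia. revert l Hnd Hl.
      apply (few_values (fun q s => rho s (dig q) x) (fact x) (rho_bound x)
        (fun w y => exists t, eval_steps (qs w) t x x = S y)).
      + intros q _. now apply (rho_few (fun _ => dig q)).
      + intros w y y' [t Ht] [t' Ht']. eapply eval_steps_det; eassumption.
    - apply jump_traced.
  Qed.

  (* With oracle [A], the branch at each level is read off from [A] itself. *)
  Definition branch_of s i w := bmin (fun j => A (len w + (cap s i + j))) i.
  Definition read_guess x s := branch_of s x (rho s (branch_of s) x).

  Lemma branch_stage s i w : cap s i = cap (S s) i -> branch_of s i w = branch_of (S s) i w.
  Proof. intros E. unfold branch_of. now rewrite E. Qed.

  Lemma read_guess_few x :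
    few (fun s => read_guess x s <> read_guess x (S s)) (rho_bound x + 1).
  Proof.
    eapply few_impl; [| apply le_n |
      exact (few_or _ _ _ _ (rho_few branch_of branch_stage x) (cap_few x))].
    cbv beta. intros s Hne. unfold read_guess in Hne.
    destruct (Nat.eq_dec (cap s x) (cap (S s) x)) as [E |]; [left | now right].
    intros Er. apply Hne. rewrite <- Er. now apply branch_stage.
  Qed.

  Lemma branch_correct s i : rho s (path s) i = rl i -> rho s (path s) (S i) = rl (S i) ->
    branch_of s i (rl i) = guess s i.
  Proof.
    intros E1 E2. pose proof (rho_S_ext s (path s) i) as He. rewrite E1, E2 in He.
    apply (ext_below A) in He; [| apply rl_below].
    unfold path in He. apply bmin_eq.
    - pose proof (guess_le s i). pose proof (snd_le i). lia.
    - intros j Hj. rewrite He by (rewrite len_app; lia). apply app_bit_pad. lia.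
    - intros _. rewrite He by (rewrite len_app; lia). apply app_bit_last.
  Qed.

  Lemma read_guess_limit x :
    exists t0, forall t, t0 <= t -> read_guess x t = zl x.
  Proof.
    assert (H : forall n, exists t0, forall t, t0 <= t ->
      forall i, i <= n -> rho t (path t) i = rl i).
    { induction n as [|n [t0 IH]].
      - destruct (Hrl 0) as [t0 H]. exists t0. intros t Ht i Hi.
        replace i with 0 by lia. auto.
      - destruct (Hrl (S n)) as [t1 H]. exists (t0 + t1). intros t Ht i Hi.
        destruct (Nat.eq_dec i (S n)) as [-> |]; [apply H; lia | apply IH; lia]. }
    (* One level beyond [x] is needed, since the branch at [x] is coded in the string at level
       [S x]. *)
    destruct (H (S x)) as [t1 H1]. destruct (Hzl x) as [t2 H2].
    exists (t1 + t2). intros t Ht. specialize (H1 t ltac:(lia)).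
    (* The reader starts at the same string as the true path, and from a correct string it reads the
       correct branch. *)
    assert (Hr : forall n, n <= x -> rho t (branch_of t) n = rl n).
    { induction n as [|n IH]; intros Hn.
      - rewrite <- H1 by lia. reflexivity.
      - rewrite <- H1 by lia. rewrite !rho_eq. simpl base.
        rewrite IH, H1 by lia. unfold path at 1.
        now rewrite branch_correct by (apply H1; lia). }
    unfold read_guess. rewrite Hr by lia.
    rewrite branch_correct by (apply H1; lia). apply H2. lia.
  Qed.

  Lemma cpt_read_guess s x : cpt A s -> cpt A x ->
    cpt A (fun y => read_guess (x y) (s y)).
  Proof.
    assert (Hb : forall s i w, cpt A s -> cpt A i -> cpt A w ->
      cpt A (fun y => branch_of (s y) (i y) (w y))).
    { intros s0 i w H1 H2 H3. unfold branch_of, len. apply cpt_bmin; [| assumption].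
      apply cpt_oracle.
      assert (cpt A (fun p => cap (s0 (fst_of p)) (i (fst_of p)))) by (apply cpt_cap; cpt).
      cpt. }
    intros Hs Hx. unfold read_guess. apply Hb; auto.
    apply (cpt_rho A s x (fun y => branch_of (s y))); auto. apply Hb; cpt.
  Qed.

  Lemma A_not_BLR_traceable : ~ BLR_traceable A.
  Proof.
    intros (h & (Hh & _ & _) & Htr).
    (* At argument [n] the level for traces of size at most [h n] is selected. *)
    set (lvl := fun n => pair n (h n)).
    destruct (Htr (fun n => zl (lvl n)))
      as (r & (c & G & b & HG & [d Hd] & Hch & Hlim) & Hcard & Hin).
    - destruct (code_of_cpt2 A (fun n t => read_guess (lvl n) t)) as [c Hc].
      { apply computable_cpt with (O := A) in Hh.
        apply cpt_read_guess; unfold lvl; cpt. }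
      exists c, (fun n t => read_guess (lvl n) t), (fun n => rho_bound (lvl n) + 1).
      repeat split.
      + exact Hc.
      + apply cpt_computable. apply computable_cpt with (O := emptyO) in Hh.
        assert (cpt emptyO (fun n => rho_bound (lvl n)))
          by (apply cpt_rho_bound; unfold lvl; cpt).
        cpt.
      + intros n. apply few_card, read_guess_few.
      + intros n. apply read_guess_limit.
    (* The trace fails at the argument that encodes its own approximation and change bound. *)
    - apply (guess_avoids c d (h (pair c d)) G b r HG Hd Hch Hlim (zl (lvl (pair c d)))
        (Hcard _) (Hzl _)).
      apply Hin.
  Qed.
End Limit.

Theorem mainTheorem7 :
  exists A : nat -> bool,
    omega_ce_set A /\ jump_traceable A /\ ~ BLR_traceable A.
Proof.
  destruct (limit_fun approxA) as [A HA].
  { intros m. apply (few_limit (fun s => approxA s m) _ (approxA_few m)). }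
  destruct (limit_fun (fun t n => rho t (path t) n) path_settle) as [rl Hrl].
  destruct (limit_fun guess guess_limit) as [zl Hzl].
  exists A. repeat split.
  - now apply A_omega_ce.
  - now apply A_jump_traceable with rl.
  - now apply A_not_BLR_traceable with rl zl.
Qed.
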